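(* Let $f\in\mathcal{K}$ have radius of convergence $R>0$ and fulcrum $F$. Assume that $$\limsup_{s\uparrow\ln R}\frac{|F^{(k)}(s)|}{F''(s)^{k/2}}<+\infty\quad\text{for every integer }k\ge3.$$ Then $f$ is Gaussian if and only if $$\lim_{s\uparrow\ln R}\frac{F^{(k)}(s)}{F''(s)^{k/2}}=0\quad\text{for every integer }k\ge3.$$
   Context: The class $\mathcal{K}$ consists of non-constant power series $f(z)=\sum_{n\ge0}a_nz^n$ with radius of convergence $R\in(0,+\infty]$, with $a_n\ge 0$ for all $n$ and $a_0>0$. For $t\in(0,R)$, $X_t$ is the random variable with $\mathbf{P}(X_t=n)=a_nt^n/f(t)$, $n\ge0$. Write $m_f(t)=\mathbf{E}(X_t)$, $\sigma_f^2(t)=\mathbf{V}(X_t)>0$ and $\breve{X}_t=(X_t-m_f(t))/\sigma_f(t)$. $f$ is called Gaussian if $\breve{X}_t$ converges in distribution to a standard normal random variable as $t\uparrow R$. The fulcrum of $f$ is $F(s)=\ln f(e^s)$ for real $s<\ln R$ (with $\ln R=+\infty$ if $R=+\infty$); $F''(s)=\sigma_f^2(e^s)$. *)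

(* Defs.v *)
From Stdlib Require Import Reals.
From Coquelicot Require Import Coquelicot.
Open Scope R_scope.

(* A power series f(z) = sum a_n z^n is represented by its coefficients a. *)

Definition in_class_K (a : nat -> R) : Prop :=
  (forall n, 0 <= a n) /\ 0 < a 0%nat /\ (exists n, (0 < n)%nat /\ a n <> 0)
  /\ Rbar_lt (Finite 0) (CV_radius a).

Definition fval (a : nat -> R) (t : R) : R := PSeries a t.

Definition mean_f (a : nat -> R) (t : R) : R :=
  Series (fun n => INR n * a n * t ^ n) / fval a t.

Definition var_f (a : nat -> R) (t : R) : R :=
  Series (fun n => INR n ^ 2 * a n * t ^ n) / fval a t - mean_f a t ^ 2.

Definition sigma_f (a : nat -> R) (t : R) : R := sqrt (var_f a t).

(* P( (X_t - m_f(t)) / sigma_f(t) <= x ), where P(X_t = n) = a_n t^n / f(t) *)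
Definition normalized_cdf (a : nat -> R) (t x : R) : R :=
  Series (fun n => if Rle_dec ((INR n - mean_f a t) / sigma_f a t) x
                   then a n * t ^ n / fval a t else 0).

Definition std_normal_cdf (x : R) : R :=
  RInt_gen (fun u => exp (- u ^ 2 / 2) / sqrt (2 * PI))
           (Rbar_locally m_infty) (at_point x).

Definition eventually_t_up_R (a : nat -> R) (P : R -> Prop) : Prop :=
  exists t0, 0 < t0 /\ Rbar_lt (Finite t0) (CV_radius a) /\
    forall t, t0 < t -> Rbar_lt (Finite t) (CV_radius a) -> P t.

(* "eventually as s increases to ln R"; note s < ln R iff exp s < R
   (with ln(+oo) = +oo). *)
Definition eventually_s_up_lnR (a : nat -> R) (P : R -> Prop) : Prop :=
  exists s0, Rbar_lt (Finite (exp s0)) (CV_radius a) /\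
    forall s, s0 < s -> Rbar_lt (Finite (exp s)) (CV_radius a) -> P s.

(* f is Gaussian: the normalized X_t converges in distribution to N(0,1)
   as t -> R^-, i.e. the distribution functions converge at every x
   (every x is a continuity point of the standard normal cdf). *)
Definition gaussian (a : nat -> R) : Prop :=
  forall x eps, 0 < eps ->
    eventually_t_up_R a (fun t => Rabs (normalized_cdf a t x - std_normal_cdf x) < eps).

Definition fulcrum (a : nat -> R) (s : R) : R := ln (fval a (exp s)).

Definition cumulant_ratio (a : nat -> R) (k : nat) (s : R) : R :=
  Derive_n (fulcrum a) k s / Rpower (Derive_n (fulcrum a) 2 s) (INR k / 2).

(* Main.v *)
(* Under the exponential family (X_t), the derivatives of the fulcrum are the cumulants of X_t,
   so the hypotheses speak about the cumulants of the normalized variable, which determine its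
   moments by the recursion c_(n+1) = sum_j C(n,j) kappa_(j+1) c_(n-j). All normalized cumulants
   of order k >= 3 tend to 0 if and only if all normalized moments tend to the Gaussian ones.

   If the moments converge, the expectation of cos (th y + ph) converges by Taylor expansion,
   because th^(2p) E(N^(2p)) / (2p)! = (th^2/2)^p / p! tends to 0; the indicator of a half-line is
   squeezed between trigonometric polynomials up to an error eta (1 + y^2).
   Conversely, if the distribution functions converge and the moments stay bounded, y^k is
   approximated by step functions up to an error eta (1 + y^(2k+2)), so the moments converge. *)

(* The line is not compact, so neither kind of approximation can be uniform. Errors are instead
   measured by a majorant whose expectation is small under both laws being compared. This uses only
   linearity and monotonicity of expectations, so the argument is carried out for abstract positive
   linear functionals. On the Gaussian side the functional is the integral over [-M, M]. It is
   compared with the law at [s] along the product of the filters s -> ln R and M -> oo, so that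
   integrals stay proper and the limits needed from the Gaussian are those of its moments and of its
   half-line masses. The boundedness hypothesis enters in the direction from Gaussian to cumulants:
   bounded cumulants give bounded moments, which act as uniform integrability. The recursion can be
   solved for either sequence because the highest cumulant occurs in it with coefficient c_0 = 1. *)
Require Import Defs.
From Stdlib Require Import Reals Arith Wf_nat Lra Lia FunctionalExtensionality.
From Coquelicot Require Import Coquelicot.
Open Scope R_scope.

(** * Moments and cumulants *)

(* [leib n K C 0 0] is [sum_j binom(n,j) K_j C_(n-j)]; Pascal's rule is built into the
   recursion, so no binomial coefficients occur. *)
Fixpoint leib (n : nat) (K C : nat -> R) (i j : nat) : R :=
  match n with
  | O => K i * C j
  | S n => leib n K C (S i) j + leib n K C i (S j)
  end.

Lemma leib_ext n K C K' C' i j :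
  (forall i, K i = K' i) -> (forall j, C j = C' j) ->
  leib n K C i j = leib n K' C' i j.
Proof.
  intros HK HC; revert i j; induction n as [|n IH]; intros i j; simpl.
  - now rewrite HK, HC.
  - now rewrite !IH.
Qed.

(** In every term of the sum the two indices add up to i + j + n, so geometric factors with the same
    ratio come out as one constant. This serves both for a constant factor (q = 1) and for division
    by powers of the standard deviation. *)
Lemma leib_scale n K C p r q i j :
  leib n (fun i => K i * (p * q ^ i)) (fun j => C j * (r * q ^ j)) i j
  = leib n K C i j * (p * r * q ^ (i + j + n)).
Proof.
  revert i j; induction n as [|n IH]; intros i j; simpl.
  - rewrite Nat.add_0_r, pow_add; ring.
  - rewrite !IH.
    replace (S i + j + n)%nat with (S (i + j + n)) by lia.
    replace (i + S j + n)%nat with (S (i + j + n)) by lia.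
    replace (i + j + S n)%nat with (S (i + j + n)) by lia.
    ring.
Qed.

(** The product rule raises one of the two indices by one, which is exactly the recursive clause of
    [leib]. *)
Lemma is_derive_leib n (K C : nat -> R -> R) s i j :
  (forall i, is_derive (K i) s (K (S i) s)) ->
  (forall j, is_derive (C j) s (C (S j) s)) ->
  is_derive (fun s => leib n (fun i => K i s) (fun j => C j s) i j) s
    (leib (S n) (fun i => K i s) (fun j => C j s) i j).
Proof.
  intros HK HC; revert i j; induction n as [|n IH]; intros i j.
  - simpl.
    apply (is_derive_mult (K i) (C j) s (K (S i) s) (C (S j) s)); auto.
    intros; apply Rmult_comm.
  - apply (is_derive_plus
      (fun s => leib n (fun i => K i s) (fun j => C j s) (S i) j)
      (fun s => leib n (fun i => K i s) (fun j => C j s) i (S j))); apply IH.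
Qed.

(** * Limits and boundedness along a filter *)

Lemma lim_plus {T} (F : (T -> Prop) -> Prop) {FF : Filter F} (f g : T -> R) (l m : R) :
  filterlim f F (locally l) -> filterlim g F (locally m) ->
  filterlim (fun t => f t + g t) F (locally (l + m)).
Proof.
  intros Hf Hg.
  exact (filterlim_comp_2 f g Rplus Hf Hg (filterlim_plus (V := R_NormedModule) l m)).
Qed.

Lemma lim_mult {T} (F : (T -> Prop) -> Prop) {FF : Filter F} (f g : T -> R) (l m : R) :
  filterlim f F (locally l) -> filterlim g F (locally m) ->
  filterlim (fun t => f t * g t) F (locally (l * m)).
Proof.
  intros Hf Hg.
  exact (filterlim_comp_2 f g Rmult Hf Hg (filterlim_mult (K := R_AbsRing) l m)).
Qed.

Lemma lim_minus {T} (F : (T -> Prop) -> Prop) {FF : Filter F} (f g : T -> R) (l m : R) :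
  filterlim f F (locally l) -> filterlim g F (locally m) ->
  filterlim (fun t => f t - g t) F (locally (l - m)).
Proof.
  intros Hf Hg.
  apply (filterlim_ext (fun t => f t + (-1) * g t)). { intros; ring. }
  replace (l - m) with (l + (-1) * m) by ring.
  apply lim_plus; auto.
  apply lim_mult; auto. apply filterlim_const.
Qed.

Lemma lim_eps {T} (F : (T -> Prop) -> Prop) {FF : Filter F} (f : T -> R) (l : R) :
  filterlim f F (locally l) <-> (forall eps, 0 < eps -> F (fun t => Rabs (f t - l) < eps)).
Proof.
  rewrite filterlim_locally; split; intros H eps.
  - intros He; exact (H (mkposreal eps He)).
  - exact (H eps (cond_pos eps)).
Qed.

Definition bounded_along {T} (F : (T -> Prop) -> Prop) (f : T -> R) : Prop :=
  exists B, F (fun t => Rabs (f t) <= B).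

Lemma bounded_along_plus {T} (F : (T -> Prop) -> Prop) {FF : Filter F} (f g : T -> R) :
  bounded_along F f -> bounded_along F g -> bounded_along F (fun t => f t + g t).
Proof.
  intros [A HA] [B HB]; exists (A + B).
  generalize (filter_and _ _ HA HB); apply filter_imp; intros t [H1 H2].
  eapply Rle_trans; [apply Rabs_triang | lra].
Qed.

Lemma bounded_along_mult {T} (F : (T -> Prop) -> Prop) {FF : Filter F} (f g : T -> R) :
  bounded_along F f -> bounded_along F g -> bounded_along F (fun t => f t * g t).
Proof.
  intros [A HA] [B HB]; exists (A * B).
  generalize (filter_and _ _ HA HB); apply filter_imp; intros t [H1 H2].
  rewrite Rabs_mult; apply Rmult_le_compat; auto; apply Rabs_pos.
Qed.

Lemma bounded_along_leib {T} (F : (T -> Prop) -> Prop) {FF : Filter F} (K C : T -> nat -> R) n i j :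
  (forall i', (i' <= i + n)%nat -> bounded_along F (fun t => K t i')) ->
  (forall j', (j' <= j + n)%nat -> bounded_along F (fun t => C t j')) ->
  bounded_along F (fun t => leib n (K t) (C t) i j).
Proof.
  revert i j; induction n as [|n IH]; intros i j HK HC; simpl.
  - apply bounded_along_mult; [auto | apply HK | apply HC]; lia.
  - apply bounded_along_plus; auto; apply IH; intros; (apply HK || apply HC); lia.
Qed.

Lemma lim_leib {T} (F : (T -> Prop) -> Prop) {FF : Filter F} (K C : T -> nat -> R) k c n i j :
  (forall i', (i' <= i + n)%nat -> filterlim (fun t => K t i') F (locally (k i'))) ->
  (forall j', (j' <= j + n)%nat -> filterlim (fun t => C t j') F (locally (c j'))) ->
  filterlim (fun t => leib n (K t) (C t) i j) F (locally (leib n k c i j)).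
Proof.
  revert i j; induction n as [|n IH]; intros i j HK HC; simpl.
  - apply lim_mult; [auto | apply HK | apply HC]; lia.
  - apply lim_plus; auto; apply IH; intros; (apply HK || apply HC); lia.
Qed.

(* The term of [leib n K C i j] with the highest index of K is [K (i + n) * C j];
   the remainder only involves lower indices of K. *)
Lemma lim_leib_remainder {T} (F : (T -> Prop) -> Prop) {FF : Filter F} (K C : T -> nat -> R) k c n i j :
  (forall i', (i' < i + n)%nat -> filterlim (fun t => K t i') F (locally (k i'))) ->
  (forall j', filterlim (fun t => C t j') F (locally (c j'))) ->
  filterlim (fun t => leib n (K t) (C t) i j - K t (i + n)%nat * C t j) F
    (locally (leib n k c i j - k (i + n)%nat * c j)).
Proof.
  revert i j; induction n as [|n IH]; intros i j HK HC; simpl.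
  - rewrite Nat.add_0_r.
    replace (k i * c j - k i * c j) with 0 by ring.
    eapply filterlim_ext; [|apply filterlim_const]. intros; simpl; ring.
  - rewrite Nat.add_succ_r.
    replace (leib n k c (S i) j + leib n k c i (S j) - k (S (i + n)) * c j)
      with (leib n k c (S i) j - k (S i + n)%nat * c j + leib n k c i (S j))
      by (simpl; ring).
    eapply filterlim_ext; [|apply lim_plus; [auto|apply (IH (S i) j)|apply (lim_leib F K C k c n i (S j))]].
    + intros; simpl; ring.
    + intros; apply HK; lia.
    + auto.
    + intros; apply HK; lia.
    + auto.
Qed.

(** The moments of N(0,1): zero in odd order, the double factorial (k-1)!! in even order. The
    two-step recursion is the form that both the cumulant recursion and integration by parts
    produce. *)
Fixpoint gmom (k : nat) : R :=
  match k with
  | O => 1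
  | S O => 0
  | S (S k) => INR (S k) * gmom k
  end.

(* [gcum i] is the cumulant of order [S i] of N(0,1). *)
Definition gcum (i : nat) : R := match i with S O => 1 | _ => 0 end.

(** Only the cumulant with index 1 survives, so the binomial sum collapses to one term: from i = 0
    its coefficient is binom(n,1) = n. For n = 0 the truncated subtraction is harmless, being
    multiplied by 0. *)
Lemma leib_gcum n c i j :
  leib n gcum c i j =
  match i with O => INR n * c (j + n - 1)%nat | S O => c (j + n)%nat | _ => 0 end.
Proof.
  revert i j; induction n as [|n IH]; intros i j.
  - simpl; rewrite Nat.add_0_r; destruct i as [|[|i]]; simpl; ring.
  - simpl leib; rewrite !IH.
    destruct i as [|[|i]].
    + rewrite S_INR.
      replace (j + S n - 1)%nat with (j + n)%nat by lia.
      replace (S j + n - 1)%nat with (j + n)%nat by lia. ring.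
    + replace (S j + n)%nat with (j + S n)%nat by lia. ring.
    + ring.
Qed.

Lemma leib_gcum_gmom n : leib n gcum gmom 0 0 = gmom (S n).
Proof.
  rewrite leib_gcum; destruct n as [|n]. { simpl; ring. }
  replace (0 + S n - 1)%nat with n by lia. reflexivity.
Qed.

(* [K t i] plays the role of the normalized cumulant of order [S i]. *)
Lemma moments_of_cumulants {T} (F : (T -> Prop) -> Prop) {FF : Filter F} (K C : T -> nat -> R) :
  F (fun t => C t 0%nat = 1) ->
  (forall n, F (fun t => C t (S n) = leib n (K t) (C t) 0 0)) ->
  (forall i, filterlim (fun t => K t i) F (locally (gcum i))) ->
  forall n, filterlim (fun t => C t n) F (locally (gmom n)).
Proof.
  intros HC0 HCS HK n; induction n as [n IH] using lt_wf_ind; destruct n as [|n].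
  - eapply filterlim_ext_loc; [|apply filterlim_const].
    revert HC0; apply filter_imp; simpl; auto.
  - rewrite <- leib_gcum_gmom.
    eapply filterlim_ext_loc; [|apply (lim_leib F K C gcum gmom n 0 0)]; auto.
    + generalize (HCS n); apply filter_imp; simpl; auto.
    + intros j Hj; apply IH; lia.
Qed.

Lemma moments_bounded {T} (F : (T -> Prop) -> Prop) {FF : Filter F} (K C : T -> nat -> R) :
  F (fun t => C t 0%nat = 1) ->
  (forall n, F (fun t => C t (S n) = leib n (K t) (C t) 0 0)) ->
  (forall i, bounded_along F (fun t => K t i)) ->
  forall n, bounded_along F (fun t => C t n).
Proof.
  intros HC0 HCS HK n; induction n as [n IH] using lt_wf_ind; destruct n as [|n].
  - exists 1; revert HC0; apply filter_imp; intros t ->.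
    rewrite Rabs_R1; lra.
  - destruct (bounded_along_leib F K C n 0 0) as [B HB]; auto.
    { intros j Hj; apply IH; lia. }
    exists B; generalize (filter_and _ _ HB (HCS n)); apply filter_imp.
    now intros t [H ->].
Qed.

(** Solves the recursion for the highest cumulant: its coefficient [C t 0] equals 1, and the
    remainder contains lower cumulants, which converge by induction. *)
Lemma cumulants_of_moments {T} (F : (T -> Prop) -> Prop) {FF : Filter F} (K C : T -> nat -> R) :
  F (fun t => C t 0%nat = 1) ->
  (forall n, F (fun t => C t (S n) = leib n (K t) (C t) 0 0)) ->
  (forall n, filterlim (fun t => C t n) F (locally (gmom n))) ->
  forall i, filterlim (fun t => K t i) F (locally (gcum i)).
Proof.
  intros HC0 HCS HC n; induction n as [n IH] using lt_wf_ind.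
  replace (gcum n) with (gmom (S n) - (leib n gcum gmom 0 0 - gcum (0 + n)%nat * gmom 0)).
  2: { rewrite leib_gcum_gmom; simpl; ring. }
  eapply filterlim_ext_loc;
    [|apply lim_minus; [auto|apply HC|apply (lim_leib_remainder F K C gcum gmom n 0 0)]]; auto.
  generalize (filter_and _ _ HC0 (HCS n)); apply filter_imp; intros t [H1 H2].
  simpl; rewrite H1, H2; ring.
Qed.

(** * Central moments of the exponential family *)

Definition in_domain (a : nat -> R) (s : R) : Prop := Rbar_lt (Finite (exp s)) (CV_radius a).

Lemma in_domain_locally a s : in_domain a s -> locally s (in_domain a).
Proof.
  unfold in_domain; intros H.
  assert (Hc : continuous exp s) by (apply (ex_derive_continuous (V := R_NormedModule)); auto_derive; auto).
  apply (Hc (fun y : R => Rbar_lt (Finite y) (CV_radius a))).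
  destruct (CV_radius a) as [r| |]; simpl in *; try easy.
  - now apply (open_lt r).
  - now apply filter_true.
Qed.

(** Coefficients of (z d/dz - c)^k f, so that unnormalized moments about [c] are values of power
    series. *)
Definition cweight (a : nat -> R) (c : R) (k n : nat) : R := (INR n - c) ^ k * a n.

Lemma PS_incr_derive (b : nat -> R) n : PS_incr_1 (PS_derive b) n = INR n * b n.
Proof.
  destruct n; [simpl; now rewrite Rmult_0_l | reflexivity].
Qed.

(** Each step applies z d/dz - c, and neither summand lowers the radius. The case c = 0 is separate
    because the radius of a scalar multiple is preserved for nonzero scalars. *)
Lemma CV_radius_cweight a c k : Rbar_le (CV_radius a) (CV_radius (cweight a c k)).
Proof.
  induction k as [|k IH].
  - rewrite (CV_radius_ext (cweight a c 0) a); [apply Rbar_le_refl|].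
    intros n; unfold cweight; simpl; ring.
  - eapply Rbar_le_trans; [exact IH|].
    destruct (Req_dec c 0) as [->|Hc].
    + rewrite (CV_radius_ext (cweight a 0 (S k)) (PS_incr_1 (PS_derive (cweight a 0 k)))).
      * rewrite CV_radius_incr_1, CV_radius_derive; apply Rbar_le_refl.
      * intros n; rewrite PS_incr_derive; unfold cweight; simpl; ring.
    + rewrite (CV_radius_ext (cweight a c (S k))
        (PS_plus (PS_incr_1 (PS_derive (cweight a c k))) (PS_scal (- c) (cweight a c k)))).
      * apply Rbar_le_trans with (2 := CV_radius_plus _ _).
        rewrite CV_radius_incr_1, CV_radius_derive, CV_radius_scal by lra.
        apply Rbar_min_case; apply Rbar_le_refl.
      * intros n; unfold PS_plus, PS_scal.
        rewrite PS_incr_derive; unfold plus, scal, cweight; simpl; unfold mult; simpl; ring.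
Qed.

Lemma in_domain_cweight a c k s : in_domain a s ->
  Rbar_lt (Rabs (exp s)) (CV_radius (cweight a c k)).
Proof.
  intros H; rewrite Rabs_pos_eq by (left; apply exp_pos).
  eapply Rbar_lt_le_trans; [exact H|apply CV_radius_cweight].
Qed.

(* The [k]-th derivative of [s |-> e^(-cs) f(e^s)]. *)
Definition tilted (a : nat -> R) (c : R) (k : nat) (s : R) : R :=
  exp (- c * s) * PSeries (cweight a c k) (exp s).

Lemma is_derive_tilted a c k s : in_domain a s ->
  is_derive (tilted a c k) s (tilted a c (S k) s).
Proof.
  intros Hs; assert (H := in_domain_cweight a c k s Hs).
  unfold tilted.
  replace (exp (- c * s) * PSeries (cweight a c (S k)) (exp s))
    with ((- c * exp (- c * s)) * PSeries (cweight a c k) (exp s) +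
          exp (- c * s) * (exp s * PSeries (PS_derive (cweight a c k)) (exp s))).
  - apply (is_derive_mult (fun s => exp (- c * s))
             (fun s => PSeries (cweight a c k) (exp s)) s).
    + auto_derive; auto; ring.
    + apply (is_derive_comp (PSeries (cweight a c k)) exp).
      * now apply is_derive_PSeries.
      * apply is_derive_exp.
    + intros; apply Rmult_comm.
  - assert (E : PSeries (cweight a c (S k)) (exp s) =
       PSeries (PS_plus (PS_incr_1 (PS_derive (cweight a c k))) (PS_scal (- c) (cweight a c k))) (exp s)).
    { apply PSeries_ext; intros n; unfold PS_plus, PS_scal.
      rewrite PS_incr_derive; unfold plus, scal, cweight; simpl; unfold mult; simpl; ring. }
    rewrite E, PSeries_plus, PSeries_incr_1, PSeries_scal.
    + ring.
    + apply ex_pseries_incr_1, ex_pseries_derive; auto.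
    + apply ex_pseries_scal; [apply Rmult_comm|]. now apply CV_radius_inside.
Qed.

Lemma ex_series_cweight a c k s : in_domain a s ->
  ex_series (fun n => (INR n - c) ^ k * a n * exp s ^ n).
Proof.
  intros Hs.
  generalize (CV_disk_inside _ _ (in_domain_cweight a c k s Hs)); intros H.
  apply ex_series_Rabs; exact H.
Qed.

Lemma PSeries_cweight a c k t :
  PSeries (cweight a c k) t = Series (fun n => (INR n - c) ^ k * a n * t ^ n).
Proof. reflexivity. Qed.

Lemma PSeries_cweight_0 a c t : PSeries (cweight a c 0) t = PSeries a t.
Proof. apply PSeries_ext; intros n; unfold cweight; simpl; ring. Qed.

Lemma Series_nonneg (u : nat -> R) : (forall n, 0 <= u n) -> ex_series u -> 0 <= Series u.
Proof.
  intros H Hu.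
  replace 0 with (Series (fun n => 0 * u n)).
  - apply Series_le; auto; intros n; specialize (H n); lra.
  - rewrite Series_scal_l; ring.
Qed.

Lemma Series_ge_term (u : nat -> R) N :
  (forall n, 0 <= u n) -> ex_series u -> u N <= Series u.
Proof.
  intros H Hu.
  rewrite (Series_incr_n u (S N)) by (lia || auto).
  apply Rle_trans with (sum_f_R0 u (pred (S N))).
  - simpl; destruct N; simpl; [lra|].
    assert (0 <= sum_f_R0 u N) by (apply cond_pos_sum; auto). lra.
  - assert (0 <= Series (fun k => u (S N + k)%nat)); [|lra].
    apply Series_nonneg; auto.
    now apply (ex_series_incr_n u (S N)).
Qed.

Lemma Series_weights_pos a s k c N : (forall n, 0 <= a n) -> in_domain a s ->
  (INR N - c) ^ (2 * k) * a N <> 0 ->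
  0 < PSeries (cweight a c (2 * k)) (exp s).
Proof.
  intros Ha Hs HN; rewrite PSeries_cweight.
  assert (He : forall n, 0 < exp s ^ n) by (intros; apply pow_lt, exp_pos).
  assert (P : forall n, 0 <= (INR n - c) ^ (2 * k) * a n).
  { intros n; apply Rmult_le_pos; auto. rewrite pow_mult; apply pow_le, pow2_ge_0. }
  eapply Rlt_le_trans;
    [|apply (Series_ge_term (fun n => (INR n - c) ^ (2 * k) * a n * exp s ^ n) N)].
  - apply Rmult_lt_0_compat; auto. specialize (P N); lra.
  - intros n; apply Rmult_le_pos; auto. left; auto.
  - now apply ex_series_cweight.
Qed.

Lemma fval_pos a s : in_class_K a -> in_domain a s -> 0 < fval a (exp s).
Proof.
  intros [Ha [H0 _]] Hs; unfold fval.
  rewrite <- (PSeries_cweight_0 a 0); apply (Series_weights_pos a s 0 0 0); auto.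
  simpl; lra.
Qed.

(** The ring generated by the quotients u_i / u_0. It is closed under differentiation when u_i' =
    u_(i+1), which gives derivatives of ln u_0 of every order without an explicit formula for
    them. *)
Inductive quotient_poly (u : nat -> R -> R) : (R -> R) -> Prop :=
| qp_quot i : quotient_poly u (fun s => u i s / u 0%nat s)
| qp_plus f g : quotient_poly u f -> quotient_poly u g -> quotient_poly u (fun s => f s + g s)
| qp_minus f g : quotient_poly u f -> quotient_poly u g -> quotient_poly u (fun s => f s - g s)
| qp_mult f g : quotient_poly u f -> quotient_poly u g -> quotient_poly u (fun s => f s * g s).

Lemma quotient_poly_derive (D : R -> Prop) u g :
  (forall i s, D s -> is_derive (u i) s (u (S i) s)) ->
  (forall s, D s -> u 0%nat s <> 0) ->
  quotient_poly u g ->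
  exists g', quotient_poly u g' /\ forall s, D s -> is_derive g s (g' s).
Proof.
  intros Hu H0 Hg; induction Hg as [i|f g _ [f' [Sf Hf]] _ [g' [Sg Hg]]
    |f g _ [f' [Sf Hf]] _ [g' [Sg Hg]]|f g Qf [f' [Sf Hf]] Qg [g' [Sg Hg]]].
  - exists (fun s => u (S i) s / u 0%nat s - u i s / u 0%nat s * (u 1%nat s / u 0%nat s)); split.
    + apply qp_minus; [apply qp_quot|apply qp_mult; apply qp_quot].
    + intros s Hs.
      evar_last; [apply (is_derive_div (u i) (u 0%nat) s); eauto|].
      simpl; field; auto.
  - exists (fun s => f' s + g' s); split; [now apply qp_plus|].
    intros s Hs; apply (is_derive_plus f g s); auto.
  - exists (fun s => f' s - g' s); split; [now apply qp_minus|].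
    intros s Hs; apply (is_derive_minus f g s); auto.
  - exists (fun s => f' s * g s + f s * g' s); split.
    { apply qp_plus; apply qp_mult; auto. }
    intros s Hs; apply (is_derive_mult f g s); auto. intros; apply Rmult_comm.
Qed.

Lemma tilted_0 a s : tilted a 0 0 s = fval a (exp s).
Proof.
  unfold tilted; rewrite PSeries_cweight_0.
  replace (- 0 * s) with 0 by ring; rewrite exp_0; unfold fval; ring.
Qed.

Lemma is_derive_fulcrum_1 a s : in_class_K a -> in_domain a s ->
  is_derive (fulcrum a) s (tilted a 0 1 s / tilted a 0 0 s).
Proof.
  intros HK Hs.
  assert (Hp := fval_pos a s HK Hs).
  apply (is_derive_ext (fun s => ln (tilted a 0 0 s))).
  { intros t; now rewrite tilted_0. }
  rewrite <- tilted_0 in Hp.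
  apply (is_derive_comp ln (tilted a 0 0) s (/ tilted a 0 0 s)).
  - apply is_derive_Reals; now apply derivable_pt_lim_ln.
  - now apply is_derive_tilted.
Qed.

Lemma Derive_n_fulcrum_quotient a k : in_class_K a ->
  exists g, quotient_poly (tilted a 0) g /\
    forall s, in_domain a s -> Derive_n (fulcrum a) (S k) s = g s.
Proof.
  intros HK; induction k as [|k [g [Qg Hg]]].
  - exists (fun s => tilted a 0 1 s / tilted a 0 0 s); split; [apply qp_quot|].
    intros s Hs; apply is_derive_unique; now apply is_derive_fulcrum_1.
  - destruct (quotient_poly_derive (in_domain a) (tilted a 0) g) as [g' [Q' H']]; auto.
    + intros; now apply is_derive_tilted.
    + intros s Hs; rewrite tilted_0; apply Rgt_not_eq; now apply fval_pos.
    + exists g'; split; auto; intros s Hs.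
      change (Derive (Derive_n (fulcrum a) (S k)) s = g' s).
      rewrite (Derive_ext_loc _ g).
      * apply is_derive_unique; auto.
      * generalize (in_domain_locally a s Hs); apply filter_imp; auto.
Qed.

(** [Derive_n] is total, so its values mean something only once differentiability is known;
    membership in [quotient_poly] on the open domain supplies it at every order. *)
Lemma is_derive_fulcrum a k s : in_class_K a -> in_domain a s ->
  is_derive (Derive_n (fulcrum a) k) s (Derive_n (fulcrum a) (S k) s).
Proof.
  intros HK Hs; destruct k as [|k].
  - apply Derive_correct; exists (tilted a 0 1 s / tilted a 0 0 s).
    now apply is_derive_fulcrum_1.
  - destruct (Derive_n_fulcrum_quotient a k HK) as [g [Qg Hg]].
    destruct (quotient_poly_derive (in_domain a) (tilted a 0) g) as [g' [Q' H']]; auto.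
    + intros; now apply is_derive_tilted.
    + intros t Ht; rewrite tilted_0; apply Rgt_not_eq; now apply fval_pos.
    + apply Derive_correct; exists (g' s).
      apply (is_derive_ext_loc g); auto.
      generalize (in_domain_locally a s Hs); apply filter_imp; intros; symmetry; auto.
Qed.

Lemma mean_fulcrum a s : in_class_K a -> in_domain a s ->
  Derive_n (fulcrum a) 1 s = mean_f a (exp s).
Proof.
  intros HK Hs.
  change (Derive (fulcrum a) s = mean_f a (exp s)).
  rewrite (is_derive_unique _ _ _ (is_derive_fulcrum_1 a s HK Hs)), tilted_0.
  unfold mean_f; f_equal; unfold tilted.
  replace (- 0 * s) with 0 by ring; rewrite exp_0, Rmult_1_l, PSeries_cweight.
  apply Series_ext; intros n; ring.
Qed.

Definition central_moment (a : nat -> R) (s : R) (k : nat) : R :=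
  PSeries (cweight a (mean_f a (exp s)) k) (exp s) / fval a (exp s).

(** Index [i] stands for the cumulant of order [S i]. Centring changes the first cumulant, to 0, and
    leaves all the others. *)
Definition central_cumulant (a : nat -> R) (s : R) (i : nat) : R :=
  match i with O => 0 | _ => Derive_n (fulcrum a) (S i) s end.

(** With G(s) = e^(-cs) f(e^s) = exp(F(s) - cs) one has G' = (F' - c) G, and Leibniz's rule gives
    the higher derivatives. The centre [c] must stay a constant while differentiating; it is set to
    the mean, which depends on [s], only afterwards. *)
Lemma tilted_leib a c n s : in_class_K a -> in_domain a s ->
  tilted a c (S n) s =
  leib n (fun i => match i with O => Derive_n (fulcrum a) 1 s - c
                              | _ => Derive_n (fulcrum a) (S i) s end)
    (fun j => tilted a c j s) 0 0.
Proof.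
  intros HK; revert s; induction n as [|n IH]; intros s Hs.
  - simpl leib.
    transitivity (Derive (tilted a c 0) s).
    { symmetry; apply is_derive_unique; now apply is_derive_tilted. }
    assert (E : forall t, in_domain a t -> tilted a c 0 t = exp (- c * t + fulcrum a t)).
    { intros t Ht; unfold tilted; rewrite PSeries_cweight_0, exp_plus.
      unfold fulcrum; rewrite exp_ln by now apply fval_pos. reflexivity. }
    rewrite (Derive_ext_loc _ (fun t => exp (- c * t + fulcrum a t))).
    2: { generalize (in_domain_locally a s Hs); apply filter_imp; auto. }
    apply is_derive_unique; rewrite E by auto.
    apply (is_derive_comp exp (fun t => - c * t + fulcrum a t) s (exp (- c * s + fulcrum a s))
      (Derive_n (fulcrum a) 1 s - c)).
    + apply is_derive_exp.
    + evar_last;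
       [apply (is_derive_plus (fun t => - c * t) (fulcrum a) s (- c));
         [auto_derive; auto; ring | exact (is_derive_fulcrum a 0 s HK Hs)]|].
      unfold plus; simpl; ring.
  - transitivity (Derive (tilted a c (S n)) s).
    { symmetry; apply is_derive_unique; now apply is_derive_tilted. }
    (* The induction hypothesis holds on a neighbourhood of [s], so both of its sides may be
       differentiated. *)
    rewrite (Derive_ext_loc _ _ s (filter_imp _ _ IH (in_domain_locally a s Hs))).
    apply is_derive_unique.
    apply (is_derive_leib n (fun i s => match i with O => Derive_n (fulcrum a) 1 s - c
                              | _ => Derive_n (fulcrum a) (S i) s end) (tilted a c)).
    + intros [|i].
      * evar_last; [apply (is_derive_minus (Derive_n (fulcrum a) 1) (fun _ => c) s);
          [exact (is_derive_fulcrum a 1 s HK Hs)|apply is_derive_const]|].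
        unfold minus, plus, opp, zero; simpl; ring.
      * now apply is_derive_fulcrum.
    + intros; now apply is_derive_tilted.
Qed.

Lemma central_moment_0 a s : in_class_K a -> in_domain a s -> central_moment a s 0 = 1.
Proof.
  intros HK Hs; unfold central_moment; rewrite PSeries_cweight_0; fold (fval a (exp s)).
  field; apply Rgt_not_eq; now apply fval_pos.
Qed.

Lemma central_moment_leib a n s : in_class_K a -> in_domain a s ->
  central_moment a s (S n) = leib n (central_cumulant a s) (central_moment a s) 0 0.
Proof.
  intros HK Hs.
  assert (Hp := fval_pos a s HK Hs).
  assert (H := tilted_leib a (mean_f a (exp s)) n s HK Hs).
  set (c := mean_f a (exp s)) in *.
  assert (Hc : forall k, central_moment a s k = tilted a c k s * (/ fval a (exp s) * / exp (- c * s))).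
  { intros k; unfold central_moment, tilted; fold c; field; split; apply Rgt_not_eq; auto; apply exp_pos. }
  (* The factors [1 ^ i] and [1 ^ j] bring the constant 1 / (f e^(-cs)) into the shape of
     [leib_scale] with q = 1. *)
  rewrite (leib_ext n (central_cumulant a s) (central_moment a s)
     (fun i => (match i with O => Derive_n (fulcrum a) 1 s - c
                              | _ => Derive_n (fulcrum a) (S i) s end) * (1 * 1 ^ i))
     (fun j => tilted a c j s * (/ fval a (exp s) * / exp (- c * s) * 1 ^ j))).
  - rewrite leib_scale, <- H, Hc, pow1; ring.
  - intros [|i]; rewrite pow1; simpl; [|ring].
    fold (Derive_n (fulcrum a) 1 s).
    change (Derive (fun x => fulcrum a x) s) with (Derive_n (fulcrum a) 1 s).
    rewrite mean_fulcrum by auto; fold c; ring.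
  - intros j; rewrite pow1, Hc; ring.
Qed.

Lemma fulcrum_var a s : in_class_K a -> in_domain a s ->
  Derive_n (fulcrum a) 2 s = central_moment a s 2.
Proof.
  intros HK Hs; rewrite central_moment_leib by auto.
  cbn [leib central_cumulant]; rewrite central_moment_0 by auto; ring.
Qed.

Lemma var_f_central a s : in_class_K a -> in_domain a s ->
  var_f a (exp s) = central_moment a s 2.
Proof.
  intros HK Hs; assert (Hp := fval_pos a s HK Hs).
  unfold central_moment; rewrite PSeries_cweight.
  set (c := mean_f a (exp s)).
  assert (E : mean_f a (exp s) * fval a (exp s) = Series (fun n => INR n * a n * exp s ^ n)).
  { unfold mean_f; field; lra. }
  fold c in E.
  assert (X0 : ex_series (fun n => a n * exp s ^ n)).
  { eapply ex_series_ext; [|apply (ex_series_cweight a 0 0 s Hs)]; intros; simpl; ring. }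
  assert (X1 : ex_series (fun n => INR n * a n * exp s ^ n)).
  { eapply ex_series_ext; [|apply (ex_series_cweight a 0 1 s Hs)]; intros; simpl; ring. }
  assert (X2 : ex_series (fun n => INR n ^ 2 * a n * exp s ^ n)).
  { eapply ex_series_ext; [|apply (ex_series_cweight a 0 2 s Hs)]; intros; simpl; ring. }
  rewrite (Series_ext _ (fun n => INR n ^ 2 * a n * exp s ^ n +
     ((-2 * c) * (INR n * a n * exp s ^ n) + c ^ 2 * (a n * exp s ^ n)))) by (intros; ring).
  rewrite Series_plus, Series_plus, !Series_scal_l; auto.
  - rewrite <- E.
    change (Series (fun n => a n * exp s ^ n)) with (fval a (exp s)).
    unfold var_f; fold c; field; lra.
  - exact (ex_series_scal (V := R_NormedModule) (-2 * c) _ X1).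
  - exact (ex_series_scal (V := R_NormedModule) (c ^ 2) _ X0).
  - exact (ex_series_plus (V := R_NormedModule) _ _
      (ex_series_scal (V := R_NormedModule) (-2 * c) _ X1)
      (ex_series_scal (V := R_NormedModule) (c ^ 2) _ X0)).
Qed.

(** At least two indices carry mass, 0 and some N > 0, and one of them differs from the mean. *)
Lemma central_moment_2_pos a s : in_class_K a -> in_domain a s -> 0 < central_moment a s 2.
Proof.
  intros HK Hs; assert (Hp := fval_pos a s HK Hs).
  destruct HK as [Ha [H0 [[N [HN HaN]] _]]].
  unfold central_moment; apply Rdiv_lt_0_compat; auto.
  set (c := mean_f a (exp s)).
  destruct (Req_dec c 0) as [Hc|Hc].
  - apply (Series_weights_pos a s 1 c N); auto.
    rewrite Hc; apply Rmult_integral_contrapositive_currified; auto.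
    apply pow_nonzero; apply Rgt_not_eq; assert (0 < INR N) by (now apply lt_0_INR); lra.
  - apply (Series_weights_pos a s 1 c 0); auto.
    apply Rmult_integral_contrapositive_currified; [|lra].
    apply pow_nonzero; simpl; lra.
Qed.

Lemma sigma_f_pos a s : in_class_K a -> in_domain a s -> 0 < sigma_f a (exp s).
Proof.
  intros HK Hs; unfold sigma_f; rewrite var_f_central by auto.
  now apply sqrt_lt_R0, central_moment_2_pos.
Qed.

Lemma sigma_f_sqr a s : in_class_K a -> in_domain a s ->
  sigma_f a (exp s) ^ 2 = Derive_n (fulcrum a) 2 s.
Proof.
  intros HK Hs; unfold sigma_f; rewrite var_f_central, fulcrum_var by auto.
  rewrite pow2_sqrt; auto; left; now apply central_moment_2_pos.
Qed.

(** * Normalized moments and cumulants *)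

Lemma Rpower_half_nat x k : 0 < x -> Rpower (x ^ 2) (INR k / 2) = x ^ k.
Proof.
  intros Hx; rewrite <- (Rpower_pow 2), Rpower_mult by auto.
  replace (INR 2 * (INR k / 2)) with (INR k) by (simpl; field).
  now apply Rpower_pow.
Qed.

Lemma Rpower_fulcrum a k s : in_class_K a -> in_domain a s ->
  Rpower (Derive_n (fulcrum a) 2 s) (INR k / 2) = sigma_f a (exp s) ^ k.
Proof.
  intros HK Hs; rewrite <- sigma_f_sqr by auto.
  now apply Rpower_half_nat, sigma_f_pos.
Qed.

Definition norm_moment (a : nat -> R) (s : R) (k : nat) : R :=
  central_moment a s k / sigma_f a (exp s) ^ k.

Definition norm_cumulant (a : nat -> R) (s : R) (i : nat) : R :=
  central_cumulant a s i / sigma_f a (exp s) ^ (S i).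

Lemma norm_moment_0 a s : in_class_K a -> in_domain a s -> norm_moment a s 0 = 1.
Proof.
  intros HK Hs; unfold norm_moment; rewrite central_moment_0 by auto; simpl; field.
Qed.

(** Apply [leib_scale] with ratio 1/sigma; the additional factor 1/sigma on the cumulants reflects
    that index [i] has order [S i]. *)
Lemma norm_moment_leib a n s : in_class_K a -> in_domain a s ->
  norm_moment a s (S n) = leib n (norm_cumulant a s) (norm_moment a s) 0 0.
Proof.
  intros HK Hs; assert (Hp := sigma_f_pos a s HK Hs).
  unfold norm_moment at 1; rewrite central_moment_leib by auto.
  rewrite (leib_ext n (norm_cumulant a s) (norm_moment a s)
    (fun i => central_cumulant a s i * (/ sigma_f a (exp s) * (/ sigma_f a (exp s)) ^ i))
    (fun j => central_moment a s j * (1 * (/ sigma_f a (exp s)) ^ j))).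
  - rewrite leib_scale; cbn [Nat.add]; rewrite pow_inv.
    simpl; field; split; [apply pow_nonzero|]; lra.
  - intros i; unfold norm_cumulant; rewrite pow_inv; simpl; field; split; [apply pow_nonzero|]; lra.
  - intros j; unfold norm_moment; rewrite pow_inv; field; apply pow_nonzero; lra.
Qed.

Lemma norm_cumulant_0 a s : norm_cumulant a s 0 = 0.
Proof. unfold norm_cumulant, central_cumulant; apply Rmult_0_l. Qed.

Lemma norm_cumulant_1 a s : in_class_K a -> in_domain a s -> norm_cumulant a s 1 = 1.
Proof.
  intros HK Hs; assert (Hp := sigma_f_pos a s HK Hs).
  unfold norm_cumulant, central_cumulant; rewrite <- sigma_f_sqr by auto.
  field; lra.
Qed.

Lemma norm_cumulant_ratio a i s : in_class_K a -> in_domain a s ->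
  norm_cumulant a s (S (S i)) = cumulant_ratio a (S (S (S i))) s.
Proof.
  intros HK Hs; unfold cumulant_ratio; now rewrite Rpower_fulcrum.
Qed.

(** * Positive linear functionals on test functions *)

Definition gdens (u : R) : R := exp (- u ^ 2 / 2) / sqrt (2 * PI).

Lemma sqrt_2PI_pos : 0 < sqrt (2 * PI).
Proof. apply sqrt_lt_R0; assert (H := PI_RGT_0); lra. Qed.

Lemma gdens_pos u : 0 < gdens u.
Proof. apply Rdiv_lt_0_compat; [apply exp_pos|apply sqrt_2PI_pos]. Qed.

Lemma is_derive_gdens u : is_derive gdens u (- u * gdens u).
Proof.
  assert (H := sqrt_2PI_pos); unfold gdens; auto_derive; auto.
  unfold Rdiv; simpl.
  match goal with |- @eq _ ?x ?y => change (@eq R x y) end.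
  field; lra.
Qed.

Lemma continuous_gdens u : continuous gdens u.
Proof. apply (ex_derive_continuous (V := R_NormedModule)); eexists; apply is_derive_gdens. Qed.

Definition halfline (c y : R) : R := if Rle_dec y c then 1 else 0.

(** One class of test functions for both functionals: the first clause is for Gaussian integrals
    over bounded intervals, the growth bound for convergence of the series that defines [law].
    Continuity is not asked for, since indicators of half-lines must belong to it. *)
Definition admissible (g : R -> R) : Prop :=
  (forall a b, ex_RInt (fun y => g y * gdens y) a b) /\
  exists C k, forall y, Rabs (g y) <= C * (1 + y ^ 2) ^ k.

Lemma growth_mono y k k' : (k <= k')%nat -> (1 + y ^ 2) ^ k <= (1 + y ^ 2) ^ k'.
Proof. intros H; apply Rle_pow; auto; assert (0 <= y ^ 2) by apply pow2_ge_0; lra. Qed.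

Lemma growth_pos y k : 1 <= (1 + y ^ 2) ^ k.
Proof. apply pow_R1_Rle; assert (0 <= y ^ 2) by apply pow2_ge_0; lra. Qed.

Lemma admissible_plus f g : admissible f -> admissible g -> admissible (fun y => f y + g y).
Proof.
  intros [If [C [k Hf]]] [Ig [C' [k' Hg]]]; split.
  - intros a b.
    apply (ex_RInt_ext (fun y => plus (f y * gdens y) (g y * gdens y))).
    { intros; unfold plus; simpl; ring. }
    now apply (ex_RInt_plus (V := R_NormedModule)).
  - exists (Rabs C + Rabs C'), (max k k'); intros y.
    eapply Rle_trans; [apply Rabs_triang|].
    assert (H1 := growth_mono y k (max k k') (Nat.le_max_l _ _)).
    assert (H2 := growth_mono y k' (max k k') (Nat.le_max_r _ _)).
    assert (P1 := growth_pos y k); assert (P2 := growth_pos y k').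
    specialize (Hf y); specialize (Hg y).
    assert (A1 := Rle_abs C); assert (A2 := Rle_abs C').
    assert (B1 := Rabs_pos C); assert (B2 := Rabs_pos C').
    rewrite Rmult_plus_distr_r; apply Rplus_le_compat.
    + eapply Rle_trans; [apply Hf|].
      apply Rle_trans with (Rabs C * (1 + y ^ 2) ^ k);
        [apply Rmult_le_compat_r | apply Rmult_le_compat_l]; lra.
    + eapply Rle_trans; [apply Hg|].
      apply Rle_trans with (Rabs C' * (1 + y ^ 2) ^ k');
        [apply Rmult_le_compat_r | apply Rmult_le_compat_l]; lra.
Qed.

Lemma admissible_scal c g : admissible g -> admissible (fun y => c * g y).
Proof.
  intros [Ig [C [k Hg]]]; split.
  - intros a b.
    apply (ex_RInt_ext (fun y => scal c (g y * gdens y))).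
    { intros; unfold scal; simpl; unfold mult; simpl; ring. }
    now apply (ex_RInt_scal (V := R_NormedModule)).
  - exists (Rabs c * C), k; intros y; rewrite Rabs_mult, Rmult_assoc.
    apply Rmult_le_compat_l; auto; apply Rabs_pos.
Qed.

Lemma admissible_minus f g : admissible f -> admissible g -> admissible (fun y => f y - g y).
Proof.
  intros Hf Hg.
  replace (fun y => f y - g y) with (fun y => f y + (-1) * g y)
    by (extensionality y; ring).
  apply admissible_plus; auto; now apply admissible_scal.
Qed.

Lemma admissible_continuous g C k :
  (forall y, continuous g y) -> (forall y, Rabs (g y) <= C * (1 + y ^ 2) ^ k) -> admissible g.
Proof.
  intros Hg HC; split; [|now exists C, k].
  intros a b; apply (ex_RInt_continuous (V := R_CompleteNormedModule)).
  intros z _; apply (continuous_mult (K := R_AbsRing) g gdens); auto.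
  apply continuous_gdens.
Qed.

Lemma admissible_pow k : admissible (fun y => y ^ k).
Proof.
  apply (admissible_continuous _ 1 k).
  - intros y; apply (ex_derive_continuous (V := R_NormedModule)); auto_derive; auto.
  - intros y; rewrite <- RPow_abs, Rmult_1_l; apply pow_incr; split; [apply Rabs_pos|].
    rewrite <- pow2_abs. assert (H := Rabs_pos y). nra.
Qed.

Lemma ex_RInt_gdens a b : ex_RInt gdens a b.
Proof.
  apply (ex_RInt_continuous (V := R_CompleteNormedModule)); intros; apply continuous_gdens.
Qed.

Lemma ex_RInt_halfline_le c a b : a <= b -> ex_RInt (fun y => halfline c y * gdens y) a b.
Proof.
  intros Hab.
  assert (L : forall a b, a <= b -> b <= c -> ex_RInt (fun y => halfline c y * gdens y) a b).
  { intros u v Huv Hv; apply (ex_RInt_ext gdens); [|apply ex_RInt_gdens].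
    intros y Hy; rewrite Rmin_left, Rmax_right in Hy by lra.
    unfold halfline; destruct Rle_dec; lra. }
  assert (G : forall a b, a <= b -> c <= a -> ex_RInt (fun y => halfline c y * gdens y) a b).
  { intros u v Huv Hu; apply (ex_RInt_ext (fun _ => 0)); [|apply ex_RInt_const].
    intros y Hy; rewrite Rmin_left, Rmax_right in Hy by lra.
    unfold halfline; destruct Rle_dec; lra. }
  destruct (Rle_dec b c); [auto|]. destruct (Rle_dec c a); [auto|].
  apply (ex_RInt_Chasles _ a c b); [apply L|apply G]; lra.
Qed.

Lemma admissible_halfline c : admissible (halfline c).
Proof.
  split.
  - intros a b; destruct (Rle_dec a b); [now apply ex_RInt_halfline_le|].
    apply ex_RInt_swap, ex_RInt_halfline_le; lra.
  - exists 1, 0%nat; intros y; unfold halfline; destruct Rle_dec; simpl;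
      rewrite ?Rabs_R1, ?Rabs_R0; lra.
Qed.

Definition pos_linear (E : (R -> R) -> R) : Prop :=
  (forall f g, admissible f -> admissible g -> E (fun y => f y + g y) = E f + E g) /\
  (forall c g, admissible g -> E (fun y => c * g y) = c * E g) /\
  (forall f g, admissible f -> admissible g -> (forall y, f y <= g y) -> E f <= E g).

Lemma pos_linear_abs E f g q : pos_linear E -> admissible f -> admissible g -> admissible q ->
  (forall y, Rabs (f y - g y) <= q y) -> Rabs (E f - E g) <= E q.
Proof.
  intros [EP [ES EL]] Hf Hg Hq H.
  assert (E f <= E g + E q).
  { rewrite <- EP by auto; apply EL; auto; [now apply admissible_plus|].
    intros y; specialize (H y); apply Rabs_le_between in H; lra. }
  assert (E g <= E f + E q).
  { rewrite <- EP by auto; apply EL; auto; [now apply admissible_plus|].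
    intros y; specialize (H y); apply Rabs_le_between in H; lra. }
  apply Rabs_le_between; lra.
Qed.

(** Only the difference has to vanish, so no limit is named: for trigonometric polynomials the
    Gaussian expectation need never be computed. *)
Definition asymp {U} (G : (U -> Prop) -> Prop) (E I : U -> (R -> R) -> R) (g : R -> R) : Prop :=
  forall eps, 0 < eps -> G (fun u => Rabs (E u g - I u g) < eps).

(** A three-epsilon argument in which the distance from [g] to [h] is measured by the expectations
    of a majorant [q], not by a supremum. *)
Lemma asymp_approx {U} (G : (U -> Prop) -> Prop) {FG : Filter G} E I g :
  G (fun u => pos_linear (E u)) -> G (fun u => pos_linear (I u)) -> admissible g ->
  (forall eps, 0 < eps -> exists h q, admissible h /\ admissible q /\ asymp G E I h /\
     (forall y, Rabs (g y - h y) <= q y) /\ G (fun u => E u q < eps /\ I u q < eps)) ->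
  asymp G E I g.
Proof.
  intros PosE PosI Hg H eps He.
  destruct (H (eps / 3)) as [h [q [Hh [Hq [Ch [Hb Hs]]]]]]; [lra|].
  assert (Ch' : G (fun u => Rabs (E u h - I u h) < eps / 3)) by (apply Ch; lra).
  generalize (filter_and _ _ (filter_and _ _ PosE PosI) (filter_and _ _ Hs Ch')).
  apply filter_imp; intros u [[HE HI] [[H1 H2] H3]].
  assert (A := pos_linear_abs _ g h q HE Hg Hh Hq Hb).
  assert (B := pos_linear_abs _ g h q HI Hg Hh Hq Hb).
  replace (E u g - I u g) with ((E u g - E u h) + (E u h - I u h) - (I u g - I u h)) by ring.
  apply Rabs_le_between in A; apply Rabs_le_between in B; apply Rabs_lt_between in H3.
  apply Rabs_lt_between; lra.
Qed.

Lemma asymp_plus {U} (G : (U -> Prop) -> Prop) {FG : Filter G} E I f g :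
  G (fun u => pos_linear (E u)) -> G (fun u => pos_linear (I u)) ->
  admissible f -> admissible g ->
  asymp G E I f -> asymp G E I g -> asymp G E I (fun y => f y + g y).
Proof.
  intros PosE PosI Af Ag Hf Hg eps He; assert (He2 : 0 < eps / 2) by lra.
  generalize (filter_and _ _ (filter_and _ _ PosE PosI)
    (filter_and _ _ (Hf _ He2) (Hg _ He2))).
  apply filter_imp; intros u [[[E1 _] [I1 _]] [H1 H2]].
  rewrite E1, I1 by auto.
  apply Rabs_lt_between in H1; apply Rabs_lt_between in H2; apply Rabs_lt_between; lra.
Qed.

Lemma asymp_scal {U} (G : (U -> Prop) -> Prop) {FG : Filter G} E I c g :
  G (fun u => pos_linear (E u)) -> G (fun u => pos_linear (I u)) ->
  admissible g -> asymp G E I g -> asymp G E I (fun y => c * g y).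
Proof.
  intros PosE PosI Ag Hg eps He.
  assert (Hc := Rabs_pos c).
  (* Adding 1 covers c = 0. *)
  assert (H0 : 0 < eps / (Rabs c + 1)) by (apply Rdiv_lt_0_compat; lra).
  generalize (filter_and _ _ (filter_and _ _ PosE PosI) (Hg _ H0)).
  apply filter_imp; intros u [[[_ [E1 _]] [_ [I1 _]]] H1].
  rewrite E1, I1 by auto.
  rewrite <- Rmult_minus_distr_l, Rabs_mult.
  apply Rle_lt_trans with (Rabs c * (eps / (Rabs c + 1))).
  - apply Rmult_le_compat_l; lra.
  - replace eps with ((Rabs c + 1) * (eps / (Rabs c + 1))) at 2 by (field; lra).
    apply Rmult_lt_compat_r; lra.
Qed.

(** For finite [M] this is linear and monotone on all admissible functions; the passage to the full
    Gaussian is left to the filter M -> oo. *)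
Definition trunc (M : R) (g : R -> R) : R := RInt (fun y => g y * gdens y) (- M) M.

Lemma pos_linear_trunc M : 0 <= M -> pos_linear (trunc M).
Proof.
  intros HM; unfold trunc; split; [|split].
  - intros f g [Hf _] [Hg _].
    rewrite (RInt_ext _ (fun y => plus (f y * gdens y) (g y * gdens y)))
      by (intros; unfold plus; simpl; ring).
    now apply (RInt_plus (V := R_CompleteNormedModule)).
  - intros c g [Hg _].
    rewrite (RInt_ext _ (fun y => scal c (g y * gdens y)))
      by (intros; unfold scal; simpl; unfold mult; simpl; ring).
    now apply (RInt_scal (V := R_CompleteNormedModule)).
  - intros f g [Hf _] [Hg _] H; apply RInt_le; auto; [lra|].
    intros y _; apply Rmult_le_compat_r; auto; left; apply gdens_pos.
Qed.

(** * Expectation under the normalized law *)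

Definition weight (a : nat -> R) (s : R) (n : nat) : R := a n * exp s ^ n / fval a (exp s).

Definition node (a : nat -> R) (s : R) (n : nat) : R :=
  (INR n - mean_f a (exp s)) / sigma_f a (exp s).

Definition law (a : nat -> R) (s : R) (g : R -> R) : R :=
  Series (fun n => weight a s n * g (node a s n)).

Lemma weight_nonneg a s n : in_class_K a -> in_domain a s -> 0 <= weight a s n.
Proof.
  intros HK Hs; assert (Hp := fval_pos a s HK Hs); destruct HK as [Ha _].
  unfold weight; apply Rmult_le_pos; [apply Rmult_le_pos; auto|].
  - left; apply pow_lt, exp_pos.
  - left; now apply Rinv_0_lt_compat.
Qed.

Lemma is_series_weight_pow a s k : in_class_K a -> in_domain a s ->
  is_series (fun n => weight a s n * node a s n ^ k) (norm_moment a s k).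
Proof.
  intros HK Hs; assert (Hp := fval_pos a s HK Hs); assert (Hg := sigma_f_pos a s HK Hs).
  set (c := mean_f a (exp s)).
  assert (HX := Series_correct _ (ex_series_cweight a c k s Hs)).
  apply (is_series_scal_r (/ (fval a (exp s) * sigma_f a (exp s) ^ k))) in HX.
  assert (Hk : sigma_f a (exp s) ^ k <> 0) by (apply pow_nonzero; lra).
  replace (norm_moment a s k) with
    (Series (fun n => (INR n - c) ^ k * a n * exp s ^ n) * / (fval a (exp s) * sigma_f a (exp s) ^ k)).
  - eapply is_series_ext; [|exact HX].
    intros n; simpl; unfold weight, node; fold c.
    unfold Rdiv; rewrite Rpow_mult_distr, pow_inv; field; split; auto; lra.
  - unfold norm_moment, central_moment; fold c; rewrite PSeries_cweight; field; split; auto; lra.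
Qed.

Lemma law_pow a s k : in_class_K a -> in_domain a s ->
  law a s (fun y => y ^ k) = norm_moment a s k.
Proof. intros HK Hs; apply is_series_unique; now apply is_series_weight_pow. Qed.

(** The series is dominated by those of the moments of orders 0 and 2k, through (1 + x)^k <= 2^k (1
    + x^k) with x the square of the node; this inequality is checked separately for x <= 1 and x >
    1. *)
Lemma ex_series_law a s g : in_class_K a -> in_domain a s -> admissible g ->
  ex_series (fun n => weight a s n * g (node a s n)).
Proof.
  intros HK Hs [_ [C [k HC]]].
  apply (ex_series_le (K := R_AbsRing) (V := R_CompleteNormedModule) _
    (fun n => (Rabs C * 2 ^ k) * (weight a s n * node a s n ^ 0 + weight a s n * node a s n ^ (2 * k)))).
  - intros n; unfold norm; simpl; unfold abs; simpl.
    assert (Hw := weight_nonneg a s n HK Hs).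
    rewrite Rabs_mult, (Rabs_pos_eq (weight a s n)) by auto.
    replace (Rabs C * 2 ^ k * (weight a s n * 1 + weight a s n * node a s n ^ (k + (k + 0))))
      with (weight a s n * (Rabs C * (2 ^ k * (1 + node a s n ^ (2 * k))))) by (simpl; ring).
    apply Rmult_le_compat_l; auto.
    eapply Rle_trans; [apply HC|].
    assert (A := Rle_abs C); assert (P := growth_pos (node a s n) k).
    apply Rle_trans with (Rabs C * (1 + node a s n ^ 2) ^ k); [apply Rmult_le_compat_r; lra|].
    apply Rmult_le_compat_l; [apply Rabs_pos|].
    rewrite pow_mult; set (x := node a s n ^ 2).
    assert (Hx : 0 <= x) by apply pow2_ge_0.
    assert (H2 : 0 < 2 ^ k) by (apply pow_lt; lra).
    assert (Hk : 0 <= x ^ k) by now apply pow_le.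
    destruct (Rle_dec x 1).
    + apply Rle_trans with (2 ^ k); [apply pow_incr; lra|nra].
    + apply Rle_trans with ((2 * x) ^ k); [apply pow_incr; lra|].
      rewrite Rpow_mult_distr; nra.
  - apply (ex_series_scal (V := R_NormedModule) (Rabs C * 2 ^ k)).
    apply (ex_series_plus (V := R_NormedModule)); eexists; now apply is_series_weight_pow.
Qed.

Lemma pos_linear_law a s : in_class_K a -> in_domain a s -> pos_linear (law a s).
Proof.
  intros HK Hs; unfold law; split; [|split].
  - intros f g Hf Hg.
    rewrite (Series_ext _ (fun n => weight a s n * f (node a s n) + weight a s n * g (node a s n)))
      by (intros; ring).
    apply Series_plus; now apply ex_series_law.
  - intros c g Hg.
    rewrite (Series_ext _ (fun n => c * (weight a s n * g (node a s n)))) by (intros; ring).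
    apply Series_scal_l.
  - intros f g Hf Hg H.
    assert (X := ex_series_law a s f HK Hs Hf); assert (Y := ex_series_law a s g HK Hs Hg).
    assert (0 <= Series (fun n => weight a s n * g (node a s n) - weight a s n * f (node a s n))).
    { apply Series_nonneg.
      - intros n; rewrite <- Rmult_minus_distr_l; apply Rmult_le_pos.
        + now apply weight_nonneg.
        + specialize (H (node a s n)); lra.
      - exact (ex_series_minus (V := R_NormedModule) _ _ Y X). }
    rewrite Series_minus in H0 by auto; lra.
Qed.

Lemma law_halfline a s x : law a s (halfline x) = normalized_cdf a (exp s) x.
Proof.
  apply Series_ext; intros n; unfold weight, halfline, node.
  destruct Rle_dec; ring.
Qed.

(** * The Gaussian law *)

(* Restates an equation over a Coquelicot structure on R as an equation in R, for [ring]. *)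
Ltac to_R := match goal with |- @eq _ ?x ?y => cut (@eq R x y); [exact (fun h => h)|] end.

Lemma exp_mono x y : x <= y -> exp x <= exp y.
Proof. intros [H| ->]; [left; now apply exp_increasing|right; reflexivity]. Qed.

Lemma continuous_exp_sqr u : continuous (fun u => exp (- u ^ 2 / 2)) u.
Proof. apply (ex_derive_continuous (V := R_NormedModule)); auto_derive; auto. Qed.

Lemma ex_RInt_exp_sqr a b : ex_RInt (fun u => exp (- u ^ 2 / 2)) a b.
Proof.
  apply (ex_RInt_continuous (V := R_CompleteNormedModule)); intros; apply continuous_exp_sqr.
Qed.

Lemma RInt_mult_l f a b c : ex_RInt f a b -> RInt (fun u => c * f u) a b = c * RInt f a b.
Proof. exact (RInt_scal (V := R_CompleteNormedModule) f a b c). Qed.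

(** Integrand of the classical evaluation of the Gaussian integral by differentiation under the
    integral sign; at x = 0 it is the derivative of the arctangent, whence pi. *)
Definition gauss_aux (x u : R) : R := exp (- x ^ 2 * (1 + u ^ 2) / 2) / (1 + u ^ 2).

Lemma one_plus_sqr_pos u : 0 < 1 + u ^ 2.
Proof. assert (H := pow2_ge_0 u); lra. Qed.

Lemma is_derive_gauss_aux x u :
  is_derive (fun x => gauss_aux x u) x (- x * exp (- x ^ 2 * (1 + u ^ 2) / 2)).
Proof.
  assert (H := one_plus_sqr_pos u); unfold gauss_aux; auto_derive; [lra|].
  unfold Rdiv; simpl in *.
  to_R.
  field; lra.
Qed.

Lemma ex_RInt_gauss_aux x a b : ex_RInt (gauss_aux x) a b.
Proof.
  apply (ex_RInt_continuous (V := R_CompleteNormedModule)); intros u _.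
  apply (ex_derive_continuous (V := R_NormedModule)).
  assert (H := one_plus_sqr_pos u); unfold gauss_aux; auto_derive; lra.
Qed.

Lemma is_derive_RInt_gauss_aux x :
  is_derive (fun x => RInt (gauss_aux x) 0 1) x
    (- exp (- x ^ 2 / 2) * RInt (fun u => exp (- u ^ 2 / 2)) 0 x).
Proof.
  assert (E : forall x u, Derive (fun z => gauss_aux z u) x
              = - x * exp (- x ^ 2 * (1 + u ^ 2) / 2)).
  { intros; apply is_derive_unique, is_derive_gauss_aux. }
  evar_last; [apply (is_derive_RInt_param gauss_aux 0 1 x)|].
  - apply filter_forall; intros; eexists; apply is_derive_gauss_aux.
  - intros t _.
    apply (continuity_2d_pt_ext (fun u v => (- u) * exp ((- (u * u) / 2) * (1 + v * v)))).
    { intros u v; rewrite E; f_equal; f_equal; field. }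
    assert (C1 : continuity_2d_pt (fun u v => u) x t) by apply continuity_2d_pt_id1.
    assert (C2 : continuity_2d_pt (fun u v => v) x t) by apply continuity_2d_pt_id2.
    apply (continuity_2d_pt_mult (fun u v => - u)).
    + now apply continuity_2d_pt_opp.
    + apply (continuity_1d_2d_pt_comp exp (fun u v => (- (u * u) / 2) * (1 + v * v))).
      { apply derivable_continuous_pt, derivable_pt_exp. }
      apply (continuity_2d_pt_mult (fun u v => - (u * u) / 2) (fun u v => 1 + v * v)).
      * apply (continuity_2d_pt_mult (fun u v => - (u * u)) (fun u v => / 2));
          [|apply continuity_2d_pt_const].
        apply continuity_2d_pt_opp; now apply continuity_2d_pt_mult.
      * apply (continuity_2d_pt_plus (fun u v => 1) (fun u v => v * v));
          [apply continuity_2d_pt_const|]. now apply continuity_2d_pt_mult.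
  - apply filter_forall; intros; apply ex_RInt_gauss_aux.
  (* The exponent splits as -x^2/2 - (xu)^2/2, and substituting xu turns the integral over [0,1]
     into one over [0,x]. *)
  - rewrite (RInt_ext _ (fun u => - exp (- x ^ 2 / 2) * (x * exp (- (x * u + 0) ^ 2 / 2)))).
    + assert (L := RInt_comp_lin (V := R_CompleteNormedModule) (fun u => exp (- u ^ 2 / 2)) x 0 0 1
        (ex_RInt_exp_sqr _ _)).
      rewrite !Rplus_0_r, Rmult_0_r, Rmult_1_r in L.
      rewrite <- L; apply RInt_mult_l.
      apply (ex_RInt_comp_lin (V := R_NormedModule) (fun u => exp (- u ^ 2 / 2))).
      apply ex_RInt_exp_sqr.
    + intros u _; rewrite E; simpl.
      replace (exp (- (x * (x * 1)) * (1 + u * (u * 1)) / 2)) with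
        (exp (- (x * (x * 1)) / 2) * exp (- ((x * u + 0) * ((x * u + 0) * 1)) / 2)).
      { to_R; ring. }
      rewrite <- exp_plus; f_equal; field.
Qed.

(* Both sides agree at 0, and the derivative of the left-hand side vanishes. *)
Lemma gauss_identity x :
  RInt (fun u => exp (- u ^ 2 / 2)) 0 x ^ 2 + 2 * RInt (gauss_aux x) 0 1 = PI / 2.
Proof.
  set (A := fun x => RInt (fun u => exp (- u ^ 2 / 2)) 0 x : R).
  set (B := fun x => RInt (gauss_aux x) 0 1 : R).
  assert (DA : forall x : R, is_derive A x (exp (- x ^ 2 / 2))).
  { intros y; apply (is_derive_RInt (fun u => exp (- u ^ 2 / 2)) A 0 y).
    - apply filter_forall; intros z; apply (RInt_correct (V := R_CompleteNormedModule)).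
      apply ex_RInt_exp_sqr.
    - apply continuous_exp_sqr. }
  assert (D : forall x : R, is_derive (fun x => A x ^ 2 + 2 * B x) x 0).
  { intros y.
    evar_last; [apply (is_derive_plus (fun x => A x ^ 2) (fun x => 2 * B x))|].
    - apply (is_derive_pow A 2 y _ (DA y)).
    - exact (is_derive_scal B y 2 _ (is_derive_RInt_gauss_aux y)).
    - unfold plus, A; simpl.
      to_R. ring. }
  change (A x ^ 2 + 2 * B x = PI / 2).
  transitivity (A 0 ^ 2 + 2 * B 0).
  - destruct (MVT_gen (fun x => A x ^ 2 + 2 * B x) 0 x (fun _ => 0)) as [c [_ Hc]].
    + intros; apply D.
    + intros y _; apply derivable_continuous_pt; exists 0; apply is_derive_Reals, D.
    + lra.
  - unfold A; rewrite RInt_point; unfold zero; simpl.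
    replace (B 0) with (PI / 4); [field|].
    symmetry; apply is_RInt_unique.
    apply (is_RInt_ext (fun u => / (1 + u ^ 2))).
    { intros z _; revert z; assert (Z : forall u : R, / (1 + u ^ 2) = gauss_aux 0 u); [|exact Z].
      intros u; unfold gauss_aux.
      replace (- 0 ^ 2 * (1 + u ^ 2) / 2) with 0 by (simpl; field).
      rewrite exp_0; unfold Rdiv; ring. }
    evar_last; [apply (is_RInt_derive atan)|].
    + intros u _; rewrite <- Rsqr_pow2; apply is_derive_atan.
    + intros u _; apply (ex_derive_continuous (V := R_NormedModule)).
      assert (H := one_plus_sqr_pos u); auto_derive; lra.
    + rewrite atan_0, atan_1; unfold minus, plus, opp; simpl; ring.
Qed.

(** Makes the second term of [gauss_identity] vanish at infinity, which leaves the square of the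
    Gaussian integral. *)
Lemma RInt_gauss_aux_bounds x : 0 <= RInt (gauss_aux x) 0 1 <= exp (- x ^ 2 / 2).
Proof.
  assert (P : forall u, 0 <= gauss_aux x u <= exp (- x ^ 2 / 2)).
  { intros u; unfold gauss_aux.
    assert (H := one_plus_sqr_pos u); assert (H2 := pow2_ge_0 u); assert (H3 := pow2_ge_0 x).
    assert (E := exp_pos (- x ^ 2 * (1 + u ^ 2) / 2)).
    assert (E' : exp (- x ^ 2 * (1 + u ^ 2) / 2) <= exp (- x ^ 2 / 2)).
    { apply exp_mono; nra. }
    split.
    - apply Rmult_le_pos; [lra|]. left; now apply Rinv_0_lt_compat.
    - apply Rle_div_l; auto. nra. }
  split.
  - replace 0 with (RInt (fun _ => 0) 0 1) at 1
      by (rewrite RInt_const; unfold scal; simpl; unfold mult; simpl; ring).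
    apply RInt_le; [lra|apply ex_RInt_const|apply ex_RInt_gauss_aux|].
    intros u _; apply P.
  - replace (exp (- x ^ 2 / 2)) with (RInt (fun _ => exp (- x ^ 2 / 2)) 0 1)
      by (rewrite RInt_const; unfold scal; simpl; unfold mult; simpl; ring).
    apply RInt_le; [lra|apply ex_RInt_gauss_aux|apply ex_RInt_const|].
    intros u _; apply P.
Qed.

Lemma exp_INR_mult n y : exp (INR n * y) = exp y ^ n.
Proof.
  induction n as [|n IH]; [simpl; now rewrite Rmult_0_l, exp_0|].
  rewrite S_INR, Rmult_plus_distr_r, Rmult_1_l, exp_plus, IH; simpl; ring.
Qed.

(** With n = j + 1 and y = M^2 / (2n), the inequality y <= e^y raised to the power n gives M^(2n) <=
    (2n)^n e^(M^2/2), and M^j M = M^n <= M^(2n) since M >= 1. *)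
Lemma pow_gauss_bound j M : 1 <= M ->
  M ^ j * exp (- M ^ 2 / 2) <= (2 * INR (S j)) ^ (S j) / M.
Proof.
  intros HM; set (n := S j).
  assert (Hn : 0 < INR n) by (apply lt_0_INR; unfold n; lia).
  assert (E : exp (M ^ 2 / 2) = exp (M ^ 2 / 2 / INR n) ^ n).
  { rewrite <- exp_INR_mult; f_equal; field; lra. }
  set (y := M ^ 2 / 2 / INR n) in *.
  assert (Hy : 0 <= y).
  { unfold y; apply Rmult_le_pos; [|left; now apply Rinv_0_lt_compat].
    assert (H := pow2_ge_0 M); lra. }
  assert (Hey : y <= exp y) by (assert (H := exp_ineq1_le y); lra).
  assert (H1 : y ^ n <= exp (M ^ 2 / 2)) by (rewrite E; apply pow_incr; lra).
  replace (- M ^ 2 / 2) with (- (M ^ 2 / 2)) by field; rewrite exp_Ropp.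
  assert (Hexp := exp_pos (M ^ 2 / 2)).
  change (M ^ j / exp (M ^ 2 / 2) <= (2 * INR n) ^ n / M).
  apply Rle_div_l; auto.
  apply Rle_trans with ((2 * INR n) ^ n / M * y ^ n).
  - replace ((2 * INR n) ^ n / M * y ^ n) with (M ^ (2 * n) / M).
    + apply Rle_div_r; [lra|].
      replace (M ^ j * M) with (M ^ n) by (unfold n; simpl; ring).
      apply Rle_pow; auto; lia.
    + rewrite pow_mult; replace (M ^ 2) with (2 * INR n * y) by (unfold y; field; lra).
      rewrite Rpow_mult_distr; field; lra.
  - apply Rmult_le_compat_l; auto.
    apply Rmult_le_pos; [apply pow_le; lra|left; apply Rinv_0_lt_compat; lra].
Qed.

Lemma lim_pow_gauss j :
  filterlim (fun M => M ^ j * exp (- M ^ 2 / 2)) (Rbar_locally p_infty) (locally 0).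
Proof.
  apply lim_eps; [apply Rbar_locally_filter|]; intros eps He.
  set (C := (2 * INR (S j)) ^ (S j)).
  assert (HC : 0 <= C) by (apply pow_le; assert (H := pos_INR (S j)); lra).
  exists (Rmax 1 (C / eps)); intros M HM.
  assert (H1 := Rmax_l 1 (C / eps)); assert (H2 := Rmax_r 1 (C / eps)).
  assert (HP : 0 <= M ^ j * exp (- M ^ 2 / 2)).
  { apply Rmult_le_pos; [apply pow_le; lra|left; apply exp_pos]. }
  rewrite Rminus_0_r, Rabs_pos_eq by auto.
  eapply Rle_lt_trans; [apply pow_gauss_bound; lra|fold C].
  apply Rlt_div_l; [lra|].
  assert (H3 : C / eps < M) by lra. apply Rlt_div_l in H3; lra.
Qed.

Lemma lim_pow_gdens j :
  filterlim (fun M => M ^ j * gdens M) (Rbar_locally p_infty) (locally 0).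
Proof.
  apply (filterlim_ext (fun M => M ^ j * exp (- M ^ 2 / 2) * / sqrt (2 * PI))).
  { intros; unfold gdens, Rdiv; ring. }
  replace 0 with (0 * / sqrt (2 * PI)) by ring.
  apply lim_mult; [apply Rbar_locally_filter|apply lim_pow_gauss|apply filterlim_const].
Qed.

Lemma RInt_gdens_half :
  filterlim (fun M => RInt gdens 0 M) (Rbar_locally p_infty) (locally (1 / 2)).
Proof.
  assert (HPI := PI_RGT_0); assert (Hs := sqrt_2PI_pos).
  set (A := fun x => RInt (fun u => exp (- u ^ 2 / 2)) 0 x : R).
  assert (EA : forall M, RInt gdens 0 M = A M / sqrt (2 * PI)).
  { intros M; unfold A.
    rewrite (RInt_ext _ (fun u => / sqrt (2 * PI) * exp (- u ^ 2 / 2))).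
    - rewrite RInt_mult_l by apply ex_RInt_exp_sqr. apply Rmult_comm.
    - intros u _; unfold gdens, Rdiv; apply Rmult_comm. }
  set (b := sqrt (PI / 2)).
  assert (Hb : 0 < b) by (apply sqrt_lt_R0; lra).
  assert (Hbb : b ^ 2 = PI / 2) by (apply pow2_sqrt; lra).
  assert (Hbs : b / sqrt (2 * PI) = 1 / 2).
  { replace (2 * PI) with ((2 * b) ^ 2) by (rewrite Rpow_mult_distr, Hbb; field).
    rewrite sqrt_pow2 by lra. field; lra. }
  rewrite <- Hbs.
  apply (filterlim_ext (fun M => A M * / sqrt (2 * PI))); [intros; now rewrite EA|].
  apply lim_mult; [apply Rbar_locally_filter| |apply filterlim_const].
  apply lim_eps; [apply Rbar_locally_filter|]; intros eps He.
  (* By [gauss_identity], b^2 - A^2 is twice an integral that is at most e^(-M^2/2), hence below eps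
     b. Since A >= 0, dividing by A + b >= b leaves eps. *)
  assert (L := proj1 (lim_eps _ _ _) (lim_pow_gauss 0) (eps * b / 2)).
  assert (P0 : 0 < eps * b / 2) by (assert (0 < eps * b) by (apply Rmult_lt_0_compat; auto); lra).
  assert (POS : Rbar_locally p_infty (fun M => 0 <= A M)).
  { exists 0; intros M HM; apply RInt_ge_0; [lra|apply ex_RInt_exp_sqr|].
    intros; left; apply exp_pos. }
  generalize (filter_and _ _ (L P0) POS); apply filter_imp; intros M [H1 H2].
  assert (I := gauss_identity M); fold (A M) in I; assert (J := RInt_gauss_aux_bounds M).
  simpl pow in H1; rewrite Rmult_1_l, Rminus_0_r, Rabs_pos_eq in H1 by (left; apply exp_pos).
  assert (H3 : - (eps * b) < A M ^ 2 - b ^ 2 <= 0) by (simpl pow in *; lra).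
  apply Rabs_lt_between; split; nra.
Qed.

Lemma gdens_even u : gdens (- u) = gdens u.
Proof. unfold gdens; do 3 f_equal; ring. Qed.

Lemma RInt_gdens_sym M : RInt gdens (- M) 0 = RInt gdens 0 M.
Proof.
  assert (L := RInt_comp_lin (V := R_CompleteNormedModule) gdens (-1) 0 0 M (ex_RInt_gdens _ _)).
  replace (-1 * 0 + 0) with 0 in L by ring; replace (-1 * M + 0) with (- M) in L by ring.
  assert (S := opp_RInt_swap gdens 0 (- M) (ex_RInt_gdens _ _)).
  assert (N := RInt_mult_l gdens 0 M (-1) (ex_RInt_gdens _ _)).
  rewrite (RInt_ext _ (fun y => -1 * gdens y)) in L.
  - rewrite N in L; rewrite <- L in S; unfold opp in S; simpl in S; lra.
  - intros y _; replace (-1 * y + 0) with (- y) by ring; now rewrite gdens_even.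
Qed.

(** The standard normal distribution function written with a proper integral; 1/2 is the mass of the
    negative half-line. *)
Definition gcdf (x : R) : R := 1 / 2 + RInt gdens 0 x.

Lemma RInt_gdens_split M x : RInt gdens (- M) x = RInt gdens 0 M + RInt gdens 0 x.
Proof.
  rewrite <- RInt_gdens_sym; symmetry.
  apply (RInt_Chasles gdens (- M) 0 x); apply ex_RInt_gdens.
Qed.

Lemma lim_RInt_gdens x :
  filterlim (fun M => RInt gdens (- M) x) (Rbar_locally p_infty) (locally (gcdf x)).
Proof.
  apply (filterlim_ext (fun M => RInt gdens 0 M + RInt gdens 0 x)).
  { intros; symmetry; apply RInt_gdens_split. }
  apply lim_plus; [apply Rbar_locally_filter|apply RInt_gdens_half|apply filterlim_const].
Qed.

Lemma std_normal_cdf_gcdf x : std_normal_cdf x = gcdf x.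
Proof.
  apply (is_RInt_gen_unique (V := R_CompleteNormedModule)).
  intros P HP; unfold filtermapi.
  apply (Filter_prod _ _ _ (fun a => P (RInt gdens a x)) (fun b => b = x)).
  - destruct (lim_RInt_gdens x P HP) as [M HM].
    exists (- M); intros a Ha.
    specialize (HM (- a) ltac:(lra)); now rewrite Ropp_involutive in HM.
  - reflexivity.
  - intros a b Hab ->; exists (RInt gdens a x); split; auto.
    apply (RInt_correct (V := R_CompleteNormedModule)); apply ex_RInt_gdens.
Qed.

Lemma gdens_le_1 u : gdens u <= 1.
Proof.
  unfold gdens; apply Rle_div_l; [apply sqrt_2PI_pos|].
  apply Rle_trans with 1.
  - rewrite <- exp_0; apply exp_mono; assert (H := pow2_ge_0 u); lra.
  - rewrite Rmult_1_l, <- sqrt_1; apply sqrt_le_1_alt; assert (H := PI2_1); lra.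
Qed.

(** The crude Lipschitz constant 1 comes from [gdens_le_1]; it bounds the Gaussian mass of a short
    window around a threshold. *)
Lemma gcdf_bounds x y : x <= y -> 0 <= gcdf y - gcdf x <= y - x.
Proof.
  intros Hxy; unfold gcdf.
  assert (E : RInt gdens 0 x + RInt gdens x y = RInt gdens 0 y).
  { apply (RInt_Chasles gdens 0 x y); apply ex_RInt_gdens. }
  assert (H : 0 <= RInt gdens x y).
  { apply RInt_ge_0; auto; [apply ex_RInt_gdens|]. intros; left; apply gdens_pos. }
  assert (H' : RInt gdens x y <= y - x).
  { replace (y - x) with (RInt (fun _ => 1) x y)
      by (rewrite RInt_const; unfold scal; simpl; unfold mult; simpl; ring).
    apply RInt_le; auto; [apply ex_RInt_gdens|apply ex_RInt_const|].
    intros; apply gdens_le_1. }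
  lra.
Qed.

Lemma lim_trunc_halfline x :
  filterlim (fun M => trunc M (halfline x)) (Rbar_locally p_infty) (locally (gcdf x)).
Proof.
  eapply filterlim_ext_loc; [|apply (lim_RInt_gdens x)].
  exists (Rabs x); intros M HM; apply Rabs_lt_between in HM.
  unfold trunc.
  rewrite <- (RInt_Chasles (fun y => halfline x y * gdens y) (- M) x M) by (apply ex_RInt_halfline_le; lra).
  rewrite (RInt_ext (fun y => halfline x y * gdens y) gdens (- M) x).
  - rewrite (RInt_ext (fun y => halfline x y * gdens y) (fun _ => 0) x M).
    + rewrite RInt_const; unfold plus, scal; simpl; unfold mult; simpl.
      symmetry; rewrite Rmult_0_r; apply Rplus_0_r.
    + intros y Hy; rewrite Rmin_left, Rmax_right in Hy by lra.
      unfold halfline; destruct Rle_dec; lra.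
  - intros y Hy; rewrite Rmin_left, Rmax_right in Hy by lra.
    unfold halfline; destruct Rle_dec; lra.
Qed.

(** Integration by parts: the derivative of y^(k+1) times the density is integrated over [-M, M]. *)
Lemma trunc_pow_rec k M :
  trunc M (fun y => y ^ (S (S k))) =
  INR (S k) * trunc M (fun y => y ^ k) - (M ^ S k * gdens M - (- M) ^ S k * gdens M).
Proof.
  assert (I : is_RInt (fun y => INR (S k) * (y ^ k * gdens y) - y ^ S (S k) * gdens y) (- M) M
     (M ^ S k * gdens M - (- M) ^ S k * gdens M)).
  { rewrite <- (gdens_even M) at 2.
    apply (is_RInt_derive (V := R_CompleteNormedModule) (fun y => y ^ S k * gdens y)).
    - intros y _.
      evar_last; [apply (is_derive_mult (fun y => y ^ S k) gdens y)|].
      + apply (is_derive_pow (fun y => y) (S k) y 1); apply (is_derive_id y).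
      + apply is_derive_gdens.
      + intros; apply Rmult_comm.
      + assert (Z : forall y : R, INR (S k) * 1 * y ^ k * gdens y + y ^ S k * (- y * gdens y)
            = INR (S k) * (y ^ k * gdens y) - y ^ S (S k) * gdens y) by (intros; simpl; ring).
        exact (Z y).
    - intros y _; apply (ex_derive_continuous (V := R_NormedModule)).
      unfold gdens; assert (H := sqrt_2PI_pos); auto_derive; lra. }
  assert (A1 := proj1 (admissible_pow k) (- M) M).
  assert (A2 := proj1 (admissible_pow (S (S k))) (- M) M).
  apply (RInt_correct (V := R_CompleteNormedModule)) in A1, A2.
  apply (is_RInt_scal (V := R_NormedModule) _ _ _ (INR (S k))) in A1.
  assert (I' := is_RInt_minus (V := R_NormedModule) _ _ _ _ _ _ A1 A2).
  apply (is_RInt_unique (V := R_CompleteNormedModule)) in I, I'.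
  assert (E := eq_trans (eq_sym I') I).
  change (INR (S k) * trunc M (fun y => y ^ k) + - trunc M (fun y => y ^ (S (S k))) =
    M ^ S k * gdens M - (- M) ^ S k * gdens M) in E.
  lra.
Qed.

Lemma lim_trunc_pow k :
  filterlim (fun M => trunc M (fun y => y ^ k)) (Rbar_locally p_infty) (locally (gmom k)).
Proof.
  assert (FF := Rbar_locally_filter p_infty).
  (* The recursion has step two, so the induction carries two consecutive orders. *)
  cut (filterlim (fun M => trunc M (fun y => y ^ k)) (Rbar_locally p_infty) (locally (gmom k)) /\
       filterlim (fun M => trunc M (fun y => y ^ S k)) (Rbar_locally p_infty) (locally (gmom (S k)))).
  { tauto. }
  induction k as [|k [IH1 IH2]]; split.
  - apply (filterlim_ext (fun M => RInt gdens 0 M + RInt gdens 0 M)).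
    + intros M; rewrite <- RInt_gdens_split; apply RInt_ext; intros; simpl; symmetry; apply Rmult_1_l.
    + replace (gmom 0) with (1 / 2 + 1 / 2) by (simpl; field).
      apply lim_plus; [apply FF|..]; apply RInt_gdens_half.
  - apply (filterlim_ext (fun _ => 0)); [|apply filterlim_const].
    intros M; symmetry; apply is_RInt_unique.
    evar_last; [apply (is_RInt_derive (V := R_CompleteNormedModule) (fun y => - gdens y))|].
    + intros y _; evar_last; [apply (is_derive_opp gdens), is_derive_gdens|].
      unfold opp; simpl; ring.
    + intros y _; apply (ex_derive_continuous (V := R_NormedModule)).
      unfold gdens; assert (H := sqrt_2PI_pos); auto_derive; lra.
    + rewrite gdens_even; unfold minus, plus, opp; simpl; ring.
  - exact IH2.
  - apply (filterlim_ext (fun M => INR (S k) * trunc M (fun y => y ^ k) -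
       (1 - (-1) ^ S k) * (M ^ S k * gdens M))).
    + intros M; rewrite trunc_pow_rec.
      replace ((- M) ^ S k) with ((-1) ^ S k * M ^ S k)
        by (rewrite <- Rpow_mult_distr; f_equal; ring).
      ring.
    + replace (gmom (S (S k))) with (INR (S k) * gmom k - (1 - (-1) ^ S k) * 0)
        by (cbn [gmom]; ring).
      apply lim_minus; [apply FF|..]; (apply lim_mult; [apply FF|..]); auto; try apply filterlim_const.
      apply lim_pow_gdens.
Qed.

(** * Approximation by trigonometric polynomials and step functions *)

(** The phase lets sines and the product-to-sum formula fit a single generator; constants are the
    case of frequency zero. *)
Inductive trig_poly : (R -> R) -> Prop :=
| trig_cos th ph : trig_poly (fun y => cos (th * y + ph))
| trig_plus f g : trig_poly f -> trig_poly g -> trig_poly (fun y => f y + g y)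
| trig_scal c f : trig_poly f -> trig_poly (fun y => c * f y).

Lemma trig_const c : trig_poly (fun _ => c).
Proof.
  replace (fun _ : R => c) with (fun y => c * cos (0 * y + 0)).
  - apply trig_scal, trig_cos.
  - extensionality y; replace (0 * y + 0) with 0 by ring; rewrite cos_0; ring.
Qed.

Lemma trig_mult f g : trig_poly f -> trig_poly g -> trig_poly (fun y => f y * g y).
Proof.
  intros Hf Hg; induction Hf as [th ph|f1 f2 _ IH1 _ IH2|c f _ IH].
  - induction Hg as [th' ph'|g1 g2 _ IH1 _ IH2|c g _ IH].
    + replace (fun y => cos (th * y + ph) * cos (th' * y + ph')) with
        (fun y => / 2 * (cos ((th + th') * y + (ph + ph')) + cos ((th - th') * y + (ph - ph')))).
      { apply trig_scal, (trig_plus (fun y => cos (_ * y + _))); apply trig_cos. }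
      extensionality y.
      replace ((th + th') * y + (ph + ph')) with ((th * y + ph) + (th' * y + ph')) by ring.
      replace ((th - th') * y + (ph - ph')) with ((th * y + ph) - (th' * y + ph')) by ring.
      rewrite cos_plus, cos_minus; field.
    + replace (fun y => cos (th * y + ph) * (g1 y + g2 y)) with
        (fun y => cos (th * y + ph) * g1 y + cos (th * y + ph) * g2 y)
        by (extensionality y; ring).
      now apply (trig_plus (fun y => cos (th * y + ph) * g1 y)).
    + replace (fun y => cos (th * y + ph) * (c * g y)) with
        (fun y => c * (cos (th * y + ph) * g y)) by (extensionality y; ring).
      now apply trig_scal.
  - replace (fun y => (f1 y + f2 y) * g y) with (fun y => f1 y * g y + f2 y * g y)
      by (extensionality y; ring).
    now apply (trig_plus (fun y => f1 y * g y)).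
  - replace (fun y => c * f y * g y) with (fun y => c * (f y * g y)) by (extensionality y; ring).
    now apply trig_scal.
Qed.

Lemma trig_pow f n : trig_poly f -> trig_poly (fun y => f y ^ n).
Proof.
  intros Hf; induction n as [|n IH]; simpl.
  - apply trig_const.
  - now apply (trig_mult f (fun y => f y ^ n)).
Qed.

Lemma trig_minus f g : trig_poly f -> trig_poly g -> trig_poly (fun y => f y - g y).
Proof.
  intros Hf Hg.
  replace (fun y => f y - g y) with (fun y => f y + (-1) * g y) by (extensionality y; ring).
  apply trig_plus; auto; now apply trig_scal.
Qed.

Lemma admissible_trig f : trig_poly f -> admissible f.
Proof.
  induction 1.
  - apply (admissible_continuous _ 1 0).
    + intros y; apply (ex_derive_continuous (V := R_NormedModule)); auto_derive; auto.
    + intros y; simpl; rewrite Rmult_1_l; apply Rabs_le, COS_bound.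
  - now apply admissible_plus.
  - now apply admissible_scal.
Qed.

Lemma Derive_n_cos w ph k t :
  Derive_n (fun t => cos (w * t + ph)) k t = w ^ k * cos (w * t + ph + INR k * (PI / 2)).
Proof.
  revert t; induction k as [|k IH]; intros t.
  - simpl; replace (w * t + ph + 0 * (PI / 2)) with (w * t + ph) by ring; ring.
  - change (Derive (Derive_n (fun t => cos (w * t + ph)) k) t =
      w ^ S k * cos (w * t + ph + INR (S k) * (PI / 2))).
    rewrite (Derive_ext _ _ t IH); apply is_derive_unique.
    auto_derive; auto.
    rewrite S_INR.
    replace (w * t + ph + (INR k + 1) * (PI / 2)) with ((w * t + ph + INR k * (PI / 2)) + PI / 2) by ring.
    rewrite (cos_plus _ (PI / 2)), cos_PI2, sin_PI2.
    unfold Rdiv; simpl; ring.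
Qed.

Lemma ex_derive_n_cos w ph k t : ex_derive_n (fun t => cos (w * t + ph)) k t.
Proof.
  destruct k as [|k]; [exact I|].
  apply (ex_derive_ext (fun t => w ^ k * cos (w * t + ph + INR k * (PI / 2)))).
  - intros; symmetry; apply Derive_n_cos.
  - auto_derive; auto.
Qed.

Lemma cos_taylor th ph n y :
  Rabs (cos (th * y + ph) -
    sum_f_R0 (fun m => (th ^ m * cos (ph + INR m * (PI / 2)) / INR (fact m)) * y ^ m) n)
  <= Rabs ((th * y) ^ S n) / INR (fact (S n)).
Proof.
  (* Expanding in [t] from 0 to 1 along the segment from 0 to [y] treats both signs of [y] at
     once. *)
  destruct (Taylor_Lagrange (fun t => cos ((th * y) * t + ph)) n 0 1) as [z [_ Hz]].
  - lra.
  - intros; apply ex_derive_n_cos.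
  - rewrite Rmult_1_r in Hz; rewrite Hz.
    rewrite (sum_eq _ (fun m => (th ^ m * cos (ph + INR m * (PI / 2)) / INR (fact m)) * y ^ m)).
    + rewrite Derive_n_cos, Rminus_0_r, pow1.
      match goal with |- Rabs (?a + ?b - ?a) <= _ => replace (a + b - a) with b by ring end.
      unfold Rdiv; rewrite Rmult_1_l, !Rabs_mult.
      assert (F : 0 < / INR (fact (S n))) by (apply Rinv_0_lt_compat, INR_fact_lt_0).
      rewrite (Rabs_pos_eq (/ _)) by lra.
      rewrite Rmult_comm; apply Rmult_le_compat_r; [lra|].
      rewrite <- (Rmult_1_r (Rabs ((th * y) ^ S n))) at 2.
      apply Rmult_le_compat_l; [apply Rabs_pos|apply Rabs_le, COS_bound].
    + intros i _; rewrite Derive_n_cos, Rminus_0_r, pow1, Rpow_mult_distr.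
      replace (th * y * 0 + ph) with ph by ring.
      field; apply INR_fact_neq_0.
Qed.

Lemma gmom_even_fact p : gmom (2 * p) / INR (fact (2 * p)) = (/ 2) ^ p / INR (fact p).
Proof.
  induction p as [|p IH]; [simpl; field|].
  replace (2 * S p)%nat with (S (S (2 * p))) by lia.
  cbn [gmom]; rewrite !fact_simpl, !mult_INR.
  assert (F := INR_fact_neq_0 (2 * p)); assert (F' := INR_fact_neq_0 p).
  assert (N1 : INR (S (2 * p)) <> 0) by (apply not_0_INR; lia).
  assert (N2 : INR (S p) <> 0) by (apply not_0_INR; lia).
  assert (E : INR (S (S (2 * p))) = 2 * INR (S p)).
  { rewrite <- (mult_INR 2); f_equal; lia. }
  rewrite E.
  transitivity (gmom (2 * p) / INR (fact (2 * p)) * / (2 * INR (S p))).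
  - field; auto.
  - rewrite IH; cbn [pow]; field; auto.
Qed.

Lemma asymp_of_lim {U} (G : (U -> Prop) -> Prop) {FG : Filter G} E I g l :
  filterlim (fun u => E u g) G (locally l) -> filterlim (fun u => I u g) G (locally l) ->
  asymp G E I g.
Proof.
  intros HE HI.
  assert (H := lim_minus G _ _ _ _ HE HI).
  intros eps He; generalize (proj1 (lim_eps G _ _) H eps He); apply filter_imp.
  intros u; now replace (E u g - I u g - (l - l)) with (E u g - I u g) by ring.
Qed.

Lemma admissible_sum_pow c n : admissible (fun y => sum_f_R0 (fun m => c m * y ^ m) n).
Proof.
  induction n as [|n IH]; simpl.
  - apply (admissible_scal (c 0%nat) (fun y => y ^ 0)), (admissible_pow 0).
  - apply admissible_plus; auto.
    apply (admissible_scal (c (S n)) (fun y => y ^ S n)), (admissible_pow (S n)).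
Qed.

Lemma asymp_sum_pow {U} (G : (U -> Prop) -> Prop) {FG : Filter G} E I c n :
  G (fun u => pos_linear (E u)) -> G (fun u => pos_linear (I u)) ->
  (forall k, asymp G E I (fun y => y ^ k)) ->
  asymp G E I (fun y => sum_f_R0 (fun m => c m * y ^ m) n).
Proof.
  intros PosE PosI H; induction n as [|n IH].
  - exact (asymp_scal G E I (c 0%nat) (fun y => y ^ 0) PosE PosI (admissible_pow 0) (H 0%nat)).
  - apply (asymp_plus G E I (fun y => sum_f_R0 (fun m => c m * y ^ m) n) (fun y => c (S n) * y ^ S n)); auto.
    + apply admissible_sum_pow.
    + apply admissible_scal, (admissible_pow (S n)).
    + apply (asymp_scal G E I); auto; apply (admissible_pow (S n)).
Qed.

Lemma lim_scal_eventually {U} (G : (U -> Prop) -> Prop) {FG : Filter G} E g c l eps :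
  G (fun u => pos_linear (E u)) -> admissible g ->
  filterlim (fun u => E u g) G (locally l) -> c * l < eps ->
  G (fun u => E u (fun y => c * g y) < eps).
Proof.
  intros PosE Ag H Hl.
  assert (H' := lim_mult G (fun _ => c) (fun u => E u g) c l (filterlim_const c) H).
  assert (H2 := proj1 (lim_eps G _ _) H' (eps - c * l) ltac:(lra)).
  generalize (filter_and _ _ PosE H2); apply filter_imp; intros u [[_ [ES _]] K].
  rewrite ES by auto; apply Rabs_lt_between in K; lra.
Qed.

Lemma asymp_trig {U} (G : (U -> Prop) -> Prop) {FG : Filter G} E I f :
  G (fun u => pos_linear (E u)) -> G (fun u => pos_linear (I u)) ->
  (forall k, filterlim (fun u => E u (fun y => y ^ k)) G (locally (gmom k))) ->
  (forall k, filterlim (fun u => I u (fun y => y ^ k)) G (locally (gmom k))) ->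
  trig_poly f -> asymp G E I f.
Proof.
  intros PosE PosI LE LI Hf; induction Hf as [th ph|f g Hf IHf Hg IHg|c f Hf IHf].
  - apply asymp_approx; auto; [apply admissible_trig, trig_cos|].
    intros eps He.
    destruct (cv_speed_pow_fact (th ^ 2 / 2) eps He) as [N HN].
    (* Taking [S N] makes p >= 1, so that [pred (2 * p)] is a true predecessor. *)
    assert (HN' := HN (S N) ltac:(lia)); clear HN; set (p := S N) in *.
    unfold Rdist in HN'; rewrite Rminus_0_r in HN'.
    assert (Hc : th ^ (2 * p) / INR (fact (2 * p)) * gmom (2 * p) < eps).
    { replace (th ^ (2 * p) / INR (fact (2 * p)) * gmom (2 * p))
        with (th ^ (2 * p) * (gmom (2 * p) / INR (fact (2 * p))))
        by (field; apply INR_fact_neq_0).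
      rewrite gmom_even_fact, pow_mult; eapply Rle_lt_trans; [apply Rle_abs|].
      replace ((th ^ 2) ^ p * ((/ 2) ^ p / INR (fact p))) with ((th ^ 2 / 2) ^ p / INR (fact p)); auto.
      unfold Rdiv; rewrite Rpow_mult_distr; ring. }
    (* Stopping at degree 2p - 1 leaves a remainder of even order: its absolute value is a monomial,
       whose expectation converges under both functionals. *)
    exists (fun y => sum_f_R0 (fun m => (th ^ m * cos (ph + INR m * (PI / 2)) / INR (fact m)) * y ^ m) (pred (2 * p))),
      (fun y => th ^ (2 * p) / INR (fact (2 * p)) * y ^ (2 * p)).
    repeat split.
    + apply admissible_sum_pow.
    + apply admissible_sum_pow.
    + apply admissible_scal, admissible_pow.
    + apply admissible_scal, admissible_pow.
    + apply (asymp_sum_pow G E I); auto.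
      intros k; now apply (asymp_of_lim G E I _ (gmom k)).
    + intros y; eapply Rle_trans; [apply cos_taylor|].
      replace (S (pred (2 * p))) with (2 * p)%nat by (unfold p; lia).
      rewrite Rabs_pos_eq by (rewrite pow_mult; apply pow_le, pow2_ge_0).
      rewrite Rpow_mult_distr; unfold Rdiv; right; ring.
    + apply filter_and; apply (lim_scal_eventually G _ _ _ (gmom (2 * p))); auto; apply admissible_pow.
  - apply asymp_plus; auto; now apply admissible_trig.
  - apply asymp_scal; auto; now apply admissible_trig.
Qed.

Lemma bernoulli x n : -1 <= x -> 1 + INR n * x <= (1 + x) ^ n.
Proof.
  intros Hx; induction n as [|n IH]; [simpl; lra|].
  rewrite S_INR; simpl.
  assert (0 <= INR n) by apply pos_INR.
  apply Rle_trans with ((1 + x) * (1 + INR n * x)); [nra|].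
  apply Rmult_le_compat_l; lra.
Qed.

(** Bernoulli bounds 1 + Nx by (1 + x)^N, and (1 - x)^N (1 + x)^N = (1 - x^2)^N <= 1. *)
Lemma one_minus_pow_upper x N : 0 <= x <= 1 -> (1 - x) ^ N * (INR N * x) <= 1.
Proof.
  intros Hx.
  assert (B : 1 + INR N * x <= (1 + x) ^ N) by (apply bernoulli; lra).
  assert (P : 0 <= (1 - x) ^ N) by (apply pow_le; lra).
  apply Rle_trans with ((1 - x) ^ N * (1 + x) ^ N).
  - apply Rmult_le_compat_l; lra.
  - rewrite <- Rpow_mult_distr; apply Rle_trans with (1 ^ N); [|rewrite pow1; lra].
    apply pow_incr; split; nra.
Qed.

Lemma pow_unit_interval n u : 0 <= u <= 1 -> 0 <= u ^ n <= 1.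
Proof.
  intros Hu; split; [apply pow_le; lra|].
  rewrite <- (pow1 n); apply pow_incr; lra.
Qed.

(** The polynomials of Brosowski and Deutsch from the elementary proof of the Stone-Weierstrass
    theorem. The outer exponent 2^n makes Bernoulli's bounds depend on (2u)^n, which puts the
    threshold at 1/2. *)
Definition step_poly (n : nat) (u : R) : R := (1 - u ^ n) ^ (2 ^ n).

Lemma step_poly_bounds n u : 0 <= u <= 1 -> 0 <= step_poly n u <= 1.
Proof.
  intros Hu; assert (H := pow_unit_interval n u Hu).
  unfold step_poly; apply pow_unit_interval; lra.
Qed.

Lemma step_poly_lower n u : 0 <= u <= 1 -> 1 - (2 * u) ^ n <= step_poly n u.
Proof.
  intros Hu; assert (H := pow_unit_interval n u Hu).
  assert (B : 1 + INR (2 ^ n) * - u ^ n <= (1 + - u ^ n) ^ (2 ^ n)) by (apply bernoulli; lra).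
  rewrite pow_INR in B; rewrite Rpow_mult_distr; unfold step_poly, Rminus.
  replace (INR 2) with 2 in B by (simpl; ring); lra.
Qed.

Lemma step_poly_upper n u : 0 <= u <= 1 -> step_poly n u * (2 * u) ^ n <= 1.
Proof.
  intros Hu; assert (H := pow_unit_interval n u Hu).
  assert (B := one_minus_pow_upper (u ^ n) (2 ^ n) ltac:(lra)).
  rewrite pow_INR in B; rewrite Rpow_mult_distr.
  replace (INR 2) with 2 in B by (simpl; ring); exact B.
Qed.

Lemma pow_small r eps : 0 <= r < 1 -> 0 < eps -> exists N, forall n, (N <= n)%nat -> r ^ n < eps.
Proof.
  intros Hr He.
  destruct (pow_lt_1_zero r ltac:(rewrite Rabs_pos_eq; lra) eps He) as [N HN].
  exists N; intros n Hn; eapply Rle_lt_trans; [apply Rle_abs|now apply HN].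
Qed.

(* [(1 - u^n)^(2^n)] converges to 1 for [u < 1/2] and to 0 for [u > 1/2]; compose it
   with the slowly oscillating [u = (1 + sin (th (y - x))) / 2], which is monotone on a
   long interval and crosses [1/2] at [x]. *)
Lemma trig_step x d eta : 0 < d -> 0 < eta ->
  exists h, trig_poly h /\ forall y,
    halfline (x - d) y - eta * (1 + y ^ 2) <= h y <= halfline (x + d) y + eta * (1 + y ^ 2).
Proof.
  intros Hd He.
  (* For |y| >= A one has eta y^2 >= 1, and the bounds hold because the approximant lies in
     [0,1]. *)
  set (A := Rmax 1 (/ eta)).
  assert (HA1 : 1 <= A) by apply Rmax_l.
  assert (HA2 : / eta <= A) by apply Rmax_r.
  assert (Hx := Rabs_pos x).
  (* For |y| < A this keeps th (y - x) in [-1, 1], where the sine increases. *)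
  set (th := / (A + Rabs x + d)).
  assert (Hth : 0 < th) by (apply Rinv_0_lt_compat; lra).
  assert (Hth1 : th * (A + Rabs x + d) = 1) by (unfold th; field; lra).
  assert (Htd : 0 < th * d <= 1) by (split; nra).
  assert (HPI := PI2_1).
  (* The gap at the threshold: 2u <= 1 - r left of x - d and 2u >= 1 + r right of x + d, within the
     range |y| < A. *)
  set (r := sin (th * d)).
  assert (Hr : 0 < r) by (apply sin_gt_0; lra).
  assert (Hr1 : r <= 1) by apply SIN_bound.
  destruct (pow_small (1 - r) eta) as [N1 HN1]; [lra|auto|].
  destruct (pow_small (/ (1 + r)) eta) as [N2 HN2]; auto.
  { assert (Hi : (1 + r) * / (1 + r) = 1) by (field; lra).
    assert (0 < / (1 + r)) by (apply Rinv_0_lt_compat; lra). nra. }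
  set (n := max N1 N2).
  assert (H1 := HN1 n (Nat.le_max_l _ _)); assert (H2 := HN2 n (Nat.le_max_r _ _)).
  set (u := fun y => / 2 + / 2 * cos (th * y + (- th * x - PI / 2))).
  assert (Eu : forall y, u y = (1 + sin (th * (y - x))) / 2).
  { intros y; unfold u.
    replace (th * y + (- th * x - PI / 2)) with (- (PI / 2 - th * (y - x))) by ring.
    rewrite cos_neg, cos_shift; field. }
  assert (Tu : trig_poly u).
  { apply (trig_plus (fun _ => / 2)); [apply trig_const|apply trig_scal, trig_cos]. }
  exists (fun y => step_poly n (u y)); split.
  { unfold step_poly; apply trig_pow, trig_minus; [apply trig_const|now apply trig_pow]. }
  intros y.
  assert (Bu : 0 <= u y <= 1).
  { rewrite Eu; assert (B := SIN_bound (th * (y - x))); lra. }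
  assert (Bh := step_poly_bounds n (u y) Bu).
  assert (Hy2 := pow2_ge_0 y).
  assert (Hey : 0 <= eta * y ^ 2) by (apply Rmult_le_pos; lra).
  destruct (Rle_dec A (Rabs y)) as [Hbig|Hsmall].
  - assert (1 <= eta * y ^ 2).
    { rewrite <- pow2_abs.
      assert (Hi : eta * / eta = 1) by (field; lra).
      assert (/ eta <= Rabs y ^ 2) by nra.
      nra. }
    unfold halfline; do 2 destruct Rle_dec; lra.
  - apply Rnot_le_lt in Hsmall; apply Rabs_lt_between in Hsmall.
    assert (Hxb := Rle_abs x); assert (Hxb' := Rle_abs (- x)); rewrite Rabs_Ropp in Hxb'.
    assert (Hrange : -1 <= th * (y - x) <= 1) by (split; nra).
    assert (Low : y <= x - d -> 1 - eta <= step_poly n (u y)).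
    { intros Hy.
      assert (S : sin (th * (y - x)) <= - r).
      { unfold r; rewrite <- sin_neg; apply sin_incr_1; nra. }
      apply Rle_trans with (2 := step_poly_lower n (u y) Bu).
      assert ((2 * u y) ^ n <= (1 - r) ^ n); [|lra].
      apply pow_incr; rewrite Eu; assert (B := SIN_bound (th * (y - x))); lra. }
    assert (Up : x + d <= y -> step_poly n (u y) <= eta).
    { intros Hy.
      assert (S : r <= sin (th * (y - x))).
      { unfold r; apply sin_incr_1; nra. }
      assert (K := step_poly_upper n (u y) Bu).
      assert (L : (1 + r) ^ n <= (2 * u y) ^ n).
      { apply pow_incr; rewrite Eu; lra. }
      rewrite pow_inv in H2.
      assert (P : 0 < (1 + r) ^ n) by (apply pow_lt; lra).
      assert (Hi : (1 + r) ^ n * / (1 + r) ^ n = 1) by (field; lra).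
      assert (K' : step_poly n (u y) * (1 + r) ^ n <= 1).
      { eapply Rle_trans; [|exact K]; apply Rmult_le_compat_l; lra. }
      left; apply Rle_lt_trans with (2 := H2).
      apply Rmult_le_reg_r with ((1 + r) ^ n); auto. lra. }
    unfold halfline; split.
    + destruct Rle_dec as [Hy|Hy]; [specialize (Low Hy)|]; lra.
    + destruct Rle_dec as [Hy|Hy]; [lra|].
      specialize (Up ltac:(lra)); lra.
Qed.

(** The majorant is a trigonometric polynomial plus a quadratic, so its expectation under [E] can be
    transferred from [I]. Only under [I] is it then bounded by a step function; doing so under [E]
    would presuppose the claim. *)
Lemma asymp_halfline {U} (G : (U -> Prop) -> Prop) {FG : Filter G} E I x :
  G (fun u => pos_linear (E u)) -> G (fun u => pos_linear (I u)) ->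
  (forall k, filterlim (fun u => E u (fun y => y ^ k)) G (locally (gmom k))) ->
  (forall k, filterlim (fun u => I u (fun y => y ^ k)) G (locally (gmom k))) ->
  (forall x, filterlim (fun u => I u (halfline x)) G (locally (gcdf x))) ->
  asymp G E I (halfline x).
Proof.
  intros PosE PosI LE LI LH.
  apply asymp_approx; auto; [apply admissible_halfline|].
  intros eps He.
  (* The limit of [I u q'] is at most 4d + 5 eta (1 + 1) = eps/8 + eps/8; two further tolerances,
     eps/4 and eps/2, stay within eps. *)
  set (d := eps / 32); set (eta := eps / 80).
  destruct (trig_step (x + d) d eta) as [hp [Tp Hp]]; [unfold d; lra|unfold eta; lra|].
  destruct (trig_step (x - d) d eta) as [hm [Tm Hm]]; [unfold d; lra|unfold eta; lra|].
  set (w := fun y : R => y ^ 0 + y ^ 2).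
  assert (Aw : admissible w) by (apply admissible_plus; apply admissible_pow).
  assert (Ap := admissible_trig hp Tp); assert (Am := admissible_trig hm Tm).
  assert (Ah := admissible_minus hp hm Ap Am).
  (* The difference hp - hm can be as low as -2 eta w, so the factor 3 still leaves eta w to cover
     the error of [hp] from below. *)
  set (q := fun y => (hp y - hm y) + 3 * eta * w y).
  assert (Aq : admissible q) by (apply admissible_plus; auto; now apply admissible_scal).
  assert (Cq : asymp G E I q).
  { apply asymp_plus; auto; [now apply admissible_scal|apply asymp_trig; auto; now apply trig_minus|].
    apply asymp_scal; auto.
    assert (Ck : forall k, asymp G E I (fun y => y ^ k)).
    { intros k; now apply (asymp_of_lim G E I _ (gmom k)). }
    apply (asymp_plus G E I (fun y => y ^ 0) (fun y => y ^ 2)); auto; apply admissible_pow. }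
  (* Replacing [hp] and [hm] by half-lines costs eta w each, which turns 3 into 5. *)
  set (q' := fun y => (halfline (x + 2 * d) y - halfline (x - 2 * d) y) + 5 * eta * w y).
  assert (Aq' : admissible q').
  { apply admissible_plus; [apply admissible_minus; apply admissible_halfline|now apply admissible_scal]. }
  assert (Lq' : filterlim (fun u => I u q') G
      (locally (gcdf (x + 2 * d) + (-1) * gcdf (x - 2 * d) + 5 * eta * (gmom 0 + gmom 2)))).
  { eapply filterlim_ext_loc; [|apply lim_plus; [auto|apply lim_plus; [auto|apply LH|
       apply lim_mult; [auto|apply (filterlim_const (-1))|apply LH]]|apply lim_mult;
         [auto|apply (filterlim_const (5 * eta))|apply lim_plus; [auto|apply LI|apply LI]]]].
    revert PosI; apply filter_imp; intros u [IP [IS _]].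
    simpl; unfold q'.
    replace (fun y => halfline (x + 2 * d) y - halfline (x - 2 * d) y + 5 * eta * w y)
      with (fun y => (halfline (x + 2 * d) y + (-1) * halfline (x - 2 * d) y) + 5 * eta * w y)
      by (extensionality y; ring).
    assert (Hh := admissible_halfline).
    rewrite (IP (fun y => halfline (x + 2 * d) y + (-1) * halfline (x - 2 * d) y)),
      (IP (halfline (x + 2 * d))), (IS (-1)), (IS (5 * eta)); auto.
    - unfold w; rewrite (IP (fun y => y ^ 0) (fun y => y ^ 2)); auto; apply admissible_pow.
    - now apply admissible_scal.
    - apply admissible_plus; auto; now apply admissible_scal.
    - now apply admissible_scal. }
  assert (Bq : forall y, q y <= q' y).
  { intros y; unfold q, q', w; simpl (y ^ 0).
    specialize (Hp y); specialize (Hm y).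
    replace (x + d + d) with (x + 2 * d) in Hp by ring.
    replace (x - d - d) with (x - 2 * d) in Hm by ring. lra. }
  assert (Iq : G (fun u => I u q < eps / 2)).
  { assert (B := gcdf_bounds (x - 2 * d) (x + 2 * d) ltac:(unfold d; lra)).
    generalize (filter_and _ _ PosI (proj1 (lim_eps G _ _) Lq' (eps / 4) ltac:(lra))).
    apply filter_imp; intros u [[_ [_ IL]] K].
    apply Rabs_lt_between in K; simpl gmom in K.
    assert (I u q <= I u q') by (apply IL; auto).
    unfold d, eta in *; lra. }
  exists hp, q; repeat split; try apply Ap; try apply Aq.
  - now apply asymp_trig.
  - intros y; specialize (Hp y); specialize (Hm y).
    replace (x + d - d) with x in Hp by ring; replace (x - d + d) with x in Hm by ring.
    unfold q, w; simpl (y ^ 0).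
    assert (0 <= eta * (1 + y ^ 2)).
    { apply Rmult_le_pos; [unfold eta; lra|]. assert (Hy := pow2_ge_0 y); lra. }
    apply Rabs_le_between; lra.
  - generalize (filter_and _ _ Iq (Cq (eps / 2) ltac:(lra))); apply filter_imp; intros u [K1 K2].
    apply Rabs_lt_between in K2; lra.
Qed.

(** * Step functions and convergence of moments *)

Inductive step_fun : (R -> R) -> Prop :=
| step_halfline c : step_fun (halfline c)
| step_plus f g : step_fun f -> step_fun g -> step_fun (fun y => f y + g y)
| step_scal c f : step_fun f -> step_fun (fun y => c * f y).

Lemma admissible_step f : step_fun f -> admissible f.
Proof.
  induction 1; [apply admissible_halfline|now apply admissible_plus|now apply admissible_scal].
Qed.

Lemma asymp_step {U} (G : (U -> Prop) -> Prop) {FG : Filter G} E I f :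
  G (fun u => pos_linear (E u)) -> G (fun u => pos_linear (I u)) ->
  (forall x, asymp G E I (halfline x)) -> step_fun f -> asymp G E I f.
Proof.
  intros PosE PosI H Hf; induction Hf; auto.
  - apply asymp_plus; auto; now apply admissible_step.
  - apply asymp_scal; auto; now apply admissible_step.
Qed.

(** On each half-open cell the step function takes the value of [g] at the left end. It vanishes
    outside the grid, so a new cell is added without disturbing the earlier ones. *)
Lemma step_approx_grid g a h w n : 0 < h ->
  (forall x y, a <= x <= a + INR n * h -> a <= y <= a + INR n * h -> Rabs (x - y) <= h ->
     Rabs (g x - g y) <= w) ->
  exists S, step_fun S /\
    (forall y, a < y <= a + INR n * h -> Rabs (g y - S y) <= w) /\
    (forall y, y <= a \/ a + INR n * h < y -> S y = 0).
Proof.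
  intros Hh; induction n as [|n IH]; intros Hg.
  - exists (fun y => 0 * halfline 0 y); split; [apply step_scal, step_halfline|split].
    + intros y Hy; simpl in Hy; lra.
    + intros; ring.
  - rewrite S_INR in *; set (b := a + INR n * h) in *.
    assert (Hn := pos_INR n).
    assert (Eb : a + (INR n + 1) * h = b + h) by (unfold b; ring).
    rewrite Eb in *.
    assert (Hab : a <= b) by (unfold b; nra).
    destruct IH as [S [HS [H1 H2]]].
    { intros x y Hx Hy; apply Hg; lra. }
    exists (fun y => S y + g b * (halfline (b + h) y + (-1) * halfline b y)).
    split; [|split].
    + apply step_plus; auto; apply step_scal, step_plus; [|apply step_scal]; apply step_halfline.
    + intros y Hy; unfold halfline; destruct (Rle_dec y (b + h)); [|lra].
      destruct (Rle_dec y b) as [Hyb|Hyb].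
      * replace (g y - (S y + g b * (1 + -1 * 1))) with (g y - S y) by ring; apply H1; lra.
      * rewrite H2 by lra.
        replace (g y - (0 + g b * (1 + -1 * 0))) with (g y - g b) by ring.
        apply Hg; try lra. rewrite Rabs_pos_eq; lra.
    + intros y Hy; rewrite H2 by lra; unfold halfline.
      do 2 destruct Rle_dec; try lra.
Qed.

Lemma step_approx_pow k eta : 0 < eta ->
  exists S, step_fun S /\ forall y, Rabs (y ^ k - S y) <= eta * (y ^ 0 + y ^ (2 * k + 2)).
Proof.
  intros He.
  (* Outside (-A, A] the step function is 0, and |y|^k <= eta y^(2k+2) because |y| >= 1 and eta |y|
     >= 1. The exponent is even to keep the weight nonnegative. *)
  set (A := Rmax 1 (/ eta)).
  assert (HA1 : 1 <= A) by apply Rmax_l.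
  assert (HA2 : / eta <= A) by apply Rmax_r.
  destruct (Heine_cor2 (f := fun y => y ^ k) (a := - A) (b := A)) with (eps := mkposreal eta He)
    as [[dl Hdl] Hd].
  { intros y _; apply derivable_continuous_pt, derivable_pt_pow. }
  simpl in Hd.
  destruct (nfloor_ex (2 * A / dl)) as [N [_ HN]].
  { apply Rmult_le_pos; [lra|left; now apply Rinv_0_lt_compat]. }
  assert (HN0 := pos_INR N).
  (* One cell more than the integer part of 2A/dl makes the mesh smaller than the modulus of
     continuity [dl]. *)
  set (h := 2 * A / INR (S N)).
  assert (HSN : 0 < INR (S N)) by (rewrite S_INR; lra).
  assert (Hh : 0 < h) by (apply Rdiv_lt_0_compat; lra).
  assert (Hhd : h < dl).
  { unfold h; rewrite S_INR; apply Rlt_div_l; [lra|].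
    apply Rlt_div_l in HN; lra. }
  assert (EA : - A + INR (S N) * h = A) by (unfold h; field; lra).
  destruct (step_approx_grid (fun y => y ^ k) (- A) h eta (S N) Hh) as [S [HS [H1 H2]]].
  { rewrite EA; intros x y Hx Hy Hxy; left; apply Hd; lra. }
  exists S; split; auto; rewrite EA in *.
  intros y; simpl (y ^ 0).
  assert (Py : 0 <= y ^ (2 * k + 2)).
  { replace (2 * k + 2)%nat with (2 * (k + 1))%nat by lia.
    rewrite pow_mult; apply pow_le, pow2_ge_0. }
  assert (Pe : 0 <= eta * y ^ (2 * k + 2)) by (apply Rmult_le_pos; lra).
  destruct (Rle_dec y (- A)) as [L|L]; [|destruct (Rle_dec y A) as [L'|L']].
  3: assert (Hy : A <= Rabs y) by (rewrite Rabs_pos_eq; lra).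
  1: assert (Hy : A <= Rabs y) by (rewrite Rabs_left1; lra).
  2: { assert (K := H1 y ltac:(lra)); lra. }
  all: rewrite H2 by lra; rewrite Rminus_0_r, <- RPow_abs;
    rewrite <- (Rabs_pos_eq (y ^ (2 * k + 2))), <- RPow_abs by auto;
    set (z := Rabs y) in *;
    assert (Z0 : 0 <= z ^ k) by (apply pow_le; lra);
    assert (Z1 : 1 <= z ^ k) by (apply pow_R1_Rle; lra);
    assert (Hi : eta * / eta = 1) by (field; lra);
    assert (Ez : 1 <= eta * z) by nra;
    replace (z ^ (2 * k + 2)) with (z ^ k * z ^ k * z * z)
      by (rewrite pow_add; replace (2 * k)%nat with (k + k)%nat by lia; rewrite pow_add; simpl; ring);
    assert (Z2 : z ^ k * 1 <= z ^ k * (z ^ k * z)) by (apply Rmult_le_compat_l; nra);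
    assert (Z3 : z ^ k * (z ^ k * z) * 1 <= z ^ k * (z ^ k * z) * (eta * z))
      by (apply Rmult_le_compat_l; nra);
    lra.
Qed.

(** Convergence on half-lines does not by itself control powers; the bound on the moment of order 2k
    + 2 keeps mass from escaping to infinity. *)
Lemma asymp_pow {U} (G : (U -> Prop) -> Prop) {FG : Filter G} E I k :
  G (fun u => pos_linear (E u)) -> G (fun u => pos_linear (I u)) ->
  (forall k, bounded_along G (fun u => E u (fun y => y ^ k))) ->
  (forall k, bounded_along G (fun u => I u (fun y => y ^ k))) ->
  (forall x, asymp G E I (halfline x)) ->
  asymp G E I (fun y => y ^ k).
Proof.
  intros PosE PosI BE BI H; apply asymp_approx; auto; [apply admissible_pow|].
  intros eps He.
  destruct (BE 0%nat) as [b1 B1]; destruct (BE (2 * k + 2)%nat) as [b2 B2].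
  destruct (BI 0%nat) as [b3 B3]; destruct (BI (2 * k + 2)%nat) as [b4 B4].
  (* Makes 2B positive and larger than both b1 + b2 and b3 + b4, whatever the signs of these
     bounds. *)
  set (B := 1 + Rabs b1 + Rabs b2 + Rabs b3 + Rabs b4).
  assert (P1 := Rabs_pos b1); assert (P2 := Rabs_pos b2).
  assert (P3 := Rabs_pos b3); assert (P4 := Rabs_pos b4).
  assert (HB : 0 < B) by (unfold B; lra).
  set (eta := eps / (2 * B)).
  assert (Heta : 0 < eta) by (apply Rdiv_lt_0_compat; lra).
  assert (EB : eta * (2 * B) = eps) by (unfold eta; field; lra).
  destruct (step_approx_pow k eta Heta) as [S [HS HSk]].
  assert (A0 := admissible_pow 0); assert (A2 := admissible_pow (2 * k + 2)).
  assert (Aw : admissible (fun y => y ^ 0 + y ^ (2 * k + 2))) by now apply admissible_plus.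
  exists S, (fun y => eta * (y ^ 0 + y ^ (2 * k + 2))).
  split; [|split; [|split; [|split]]]; auto.
  - now apply admissible_step.
  - now apply admissible_scal.
  - now apply asymp_step.
  - generalize (filter_and _ _ (filter_and _ _ PosE PosI)
      (filter_and _ _ (filter_and _ _ B1 B2) (filter_and _ _ B3 B4))).
    apply filter_imp; intros u [[[EP [ES _]] [IP [IS _]]] [[K1 K2] [K3 K4]]].
    rewrite ES, IS, EP, IP by auto.
    apply Rabs_le_between in K1; apply Rabs_le_between in K2.
    apply Rabs_le_between in K3; apply Rabs_le_between in K4.
    assert (Q1 := Rle_abs b1); assert (Q2 := Rle_abs b2).
    assert (Q3 := Rle_abs b3); assert (Q4 := Rle_abs b4).
    rewrite <- EB; split; apply Rmult_lt_compat_l; auto; unfold B; lra.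
Qed.

(** * Convergence in distribution and convergence of moments *)

Lemma eventually_s_filter a : in_class_K a -> Filter (eventually_s_up_lnR a).
Proof.
  intros [_ [_ [_ HR]]]; split.
  - unfold eventually_s_up_lnR; destruct (CV_radius a) as [r| |]; simpl in HR; try easy.
    + exists (ln (r / 2)); split; auto.
      simpl; rewrite exp_ln; lra.
    + exists 0; split; simpl; auto.
  - intros P Q [s1 [D1 H1]] [s2 [D2 H2]]; exists (Rmax s1 s2); split.
    + unfold Rmax; destruct Rle_dec; auto.
    + intros s Hs Ds; assert (K1 := Rmax_l s1 s2); assert (K2 := Rmax_r s1 s2).
      split; [apply H1|apply H2]; auto; lra.
  - intros P Q HPQ [s0 [D0 H0]]; exists s0; split; auto.
Qed.

Lemma eventually_in_domain a : in_class_K a -> eventually_s_up_lnR a (in_domain a).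
Proof.
  intros HK; destruct (@filter_true _ _ (eventually_s_filter a HK)) as [s0 [D0 _]].
  exists s0; split; auto.
Qed.

Lemma eventually_s_t a P :
  eventually_t_up_R a P <-> eventually_s_up_lnR a (fun s => P (exp s)).
Proof.
  split.
  - intros [t0 [H0 [D H]]]; exists (ln t0); rewrite exp_ln by auto; split; auto.
    intros s Hs Ds; apply H; auto.
    rewrite <- (exp_ln t0) by auto; now apply exp_increasing.
  - intros [s0 [D H]]; exists (exp s0); split; [apply exp_pos|split; auto].
    intros t Ht Dt; assert (H0 := exp_pos s0).
    assert (Hp : 0 < t) by lra.
    rewrite <- (exp_ln t) by auto; apply H.
    + rewrite <- (ln_exp s0); now apply ln_increasing.
    + now rewrite exp_ln.
Qed.

Lemma gaussian_iff_lim a : in_class_K a ->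
  (gaussian a <-> forall x,
     filterlim (fun s => law a s (halfline x)) (eventually_s_up_lnR a) (locally (gcdf x))).
Proof.
  intros HK; assert (FF := eventually_s_filter a HK); split.
  - intros H x; apply lim_eps; auto; intros eps He.
    generalize (proj1 (eventually_s_t a _) (H x eps He)); apply filter_imp.
    intros s; now rewrite law_halfline, std_normal_cdf_gcdf.
  - intros H x eps He; apply eventually_s_t.
    generalize (proj1 (lim_eps _ _ _) (H x) eps He); apply filter_imp.
    intros s; now rewrite law_halfline, std_normal_cdf_gcdf.
Qed.

(** Removes the second variable: properness of [G] provides one [v] that is both far enough for the
    comparison and close to the limit, and this [v] is then fixed. *)
Lemma lim_of_asymp {T V} (F : (T -> Prop) -> Prop) (G : (V -> Prop) -> Prop)
  {FF : Filter F} {FG : ProperFilter G} (E : T -> (R -> R) -> R) (I : V -> (R -> R) -> R) g l :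
  asymp (filter_prod F G) (fun u => E (fst u)) (fun u => I (snd u)) g ->
  filterlim (fun v => I v g) G (locally l) ->
  filterlim (fun t => E t g) F (locally l).
Proof.
  intros H HI; apply lim_eps; auto; intros eps He.
  destruct (H (eps / 2) ltac:(lra)) as [P Q HP HQ HPQ].
  assert (HI2 : G (fun v => Rabs (I v g - l) < eps / 2)).
  { apply (proj1 (lim_eps G _ _) HI); lra. }
  destruct (filter_ex _ (filter_and _ _ HQ HI2)) as [v [Hv1 Hv2]].
  revert HP; apply filter_imp; intros t Ht.
  assert (K := HPQ t v Ht Hv1); simpl in K.
  apply Rabs_lt_between in K; apply Rabs_lt_between in Hv2; apply Rabs_lt_between; lra.
Qed.

Lemma filterlim_prod_fst {T V} (F : (T -> Prop) -> Prop) (G : (V -> Prop) -> Prop)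
  {FG : Filter G} (f : T -> R) (l : R) :
  filterlim f F (locally l) -> filterlim (fun u => f (fst u)) (filter_prod F G) (locally l).
Proof. intros H; exact (filterlim_comp _ _ _ fst f _ _ _ filterlim_fst H). Qed.

Lemma filterlim_prod_snd {T V} (F : (T -> Prop) -> Prop) (G : (V -> Prop) -> Prop)
  {FF : Filter F} (f : V -> R) (l : R) :
  filterlim f G (locally l) -> filterlim (fun u => f (snd u)) (filter_prod F G) (locally l).
Proof. intros H; exact (filterlim_comp _ _ _ snd f _ _ _ filterlim_snd H). Qed.

Lemma filterlim_bounded_along {T} (F : (T -> Prop) -> Prop) {FF : Filter F} f (l : R) :
  filterlim f F (locally l) -> bounded_along F f.
Proof.
  intros H; exists (Rabs l + 1).
  generalize (proj1 (lim_eps F _ _) H 1 Rlt_0_1); apply filter_imp; intros t Ht.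
  replace (f t) with ((f t - l) + l) by ring.
  eapply Rle_trans; [apply Rabs_triang|lra].
Qed.

Lemma eventually_pos_linear_law a : in_class_K a ->
  filter_prod (eventually_s_up_lnR a) (Rbar_locally p_infty) (fun u => pos_linear (law a (fst u))).
Proof.
  intros HK; apply (Filter_prod _ _ _ (in_domain a) (fun _ => True)).
  - now apply eventually_in_domain.
  - apply filter_true.
  - intros s M Hs _; now apply pos_linear_law.
Qed.

Lemma eventually_pos_linear_trunc a : in_class_K a ->
  filter_prod (eventually_s_up_lnR a) (Rbar_locally p_infty) (fun u => pos_linear (trunc (snd u))).
Proof.
  intros HK; assert (FF := eventually_s_filter a HK).
  apply (Filter_prod _ _ _ (fun _ => True) (fun M => 0 < M)).
  - apply filter_true.
  - exists 0; auto.
  - intros s M _ HM; apply pos_linear_trunc; simpl; lra.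
Qed.

Lemma gaussian_of_norm_moment_limit a : in_class_K a ->
  (forall k, filterlim (fun s => norm_moment a s k) (eventually_s_up_lnR a) (locally (gmom k))) ->
  gaussian a.
Proof.
  intros HK H; assert (FF := eventually_s_filter a HK).
  assert (FI := Rbar_locally_filter p_infty).
  apply gaussian_iff_lim; auto; intros x.
  apply (lim_of_asymp _ (Rbar_locally p_infty) (law a) trunc); [|apply lim_trunc_halfline].
  apply asymp_halfline.
  - apply filter_prod_filter; auto; apply FI.
  - now apply eventually_pos_linear_law.
  - now apply eventually_pos_linear_trunc.
  - intros k; apply (filterlim_prod_fst _ _ (fun s => law a s (fun y => y ^ k))).
    eapply filterlim_ext_loc; [|apply H].
    generalize (eventually_in_domain a HK); apply filter_imp.
    intros s Hs; now rewrite law_pow.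
  - intros k; apply (filterlim_prod_snd _ _ (fun M => trunc M (fun y => y ^ k))), lim_trunc_pow.
  - intros z; apply (filterlim_prod_snd _ _ (fun M => trunc M (halfline z))), lim_trunc_halfline.
Qed.

Lemma gaussian_norm_moment_limit a : in_class_K a ->
  (forall k, bounded_along (eventually_s_up_lnR a) (fun s => norm_moment a s k)) ->
  gaussian a ->
  forall k, filterlim (fun s => norm_moment a s k) (eventually_s_up_lnR a) (locally (gmom k)).
Proof.
  intros HK HB HG k; assert (FF := eventually_s_filter a HK).
  assert (FI := Rbar_locally_filter p_infty).
  assert (HG' := proj1 (gaussian_iff_lim a HK) HG).
  assert (FP : Filter (filter_prod (eventually_s_up_lnR a) (Rbar_locally p_infty))).
  { apply filter_prod_filter; auto; apply FI. }
  apply (filterlim_ext_loc (fun s => law a s (fun y => y ^ k))).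
  { generalize (eventually_in_domain a HK); apply filter_imp; intros s Hs; now rewrite law_pow. }
  apply (lim_of_asymp _ (Rbar_locally p_infty) (law a) trunc); [|apply lim_trunc_pow].
  apply asymp_pow; auto.
  - now apply eventually_pos_linear_law.
  - now apply eventually_pos_linear_trunc.
  - intros j; destruct (HB j) as [B Bj]; exists B.
    apply (Filter_prod _ _ _ (fun s => in_domain a s /\ Rabs (norm_moment a s j) <= B) (fun _ => True)).
    + apply filter_and; auto; now apply eventually_in_domain.
    + apply filter_true.
    + intros s M [Hs Hb] _; simpl; now rewrite law_pow.
  - intros j; apply (filterlim_bounded_along _ _ (gmom j)).
    apply (filterlim_prod_snd _ _ (fun M => trunc M (fun y => y ^ j))), lim_trunc_pow.
  - intros x; apply (asymp_of_lim _ _ _ _ (gcdf x)).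
    + apply (filterlim_prod_fst _ _ (fun s => law a s (halfline x))), HG'.
    + apply (filterlim_prod_snd _ _ (fun M => trunc M (halfline x))), lim_trunc_halfline.
Qed.

Theorem theorem3p4 (a : nat -> R) :
  in_class_K a ->
  (* limsup_{s -> ln R^-} |F^(k)(s)| / F''(s)^(k/2) < +oo for all k >= 3 *)
  (forall k : nat, (3 <= k)%nat ->
     exists M : R, eventually_s_up_lnR a (fun s =>
       Rabs (Derive_n (fulcrum a) k s) / Rpower (Derive_n (fulcrum a) 2 s) (INR k / 2) <= M)) ->
  (gaussian a <->
   forall k : nat, (3 <= k)%nat ->
     forall eps : R, 0 < eps ->
       eventually_s_up_lnR a (fun s => Rabs (cumulant_ratio a k s) < eps)).
Proof.
  intros HK HB; assert (FF := eventually_s_filter a HK).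
  assert (HD := eventually_in_domain a HK).
  assert (M0 : eventually_s_up_lnR a (fun s => norm_moment a s 0 = 1)).
  { revert HD; apply filter_imp; intros s Hs; now apply norm_moment_0. }
  assert (MS : forall n, eventually_s_up_lnR a
      (fun s => norm_moment a s (S n) = leib n (norm_cumulant a s) (norm_moment a s) 0 0)).
  { intros n; revert HD; apply filter_imp; intros s Hs; now apply norm_moment_leib. }
  split.
  - intros HG.
    assert (HM := gaussian_norm_moment_limit a HK).
    assert (BM : forall k, bounded_along (eventually_s_up_lnR a) (fun s => norm_moment a s k)).
    { apply (moments_bounded _ (norm_cumulant a)); auto.
      intros [|[|i]].
      - exists 0; revert HD; apply filter_imp; intros s Hs.
        rewrite norm_cumulant_0, Rabs_R0; lra.
      - exists 1; revert HD; apply filter_imp; intros s Hs.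
        rewrite norm_cumulant_1, Rabs_R1 by auto; lra.
      - destruct (HB (S (S (S i))) ltac:(lia)) as [M HM']; exists M.
        generalize (filter_and _ _ HD HM'); apply filter_imp; intros s [Hs H].
        rewrite norm_cumulant_ratio by auto; unfold cumulant_ratio.
        unfold Rdiv; rewrite Rabs_mult, (Rabs_pos_eq (/ _)); auto.
        (* [Rpower] unfolds to an exponential, hence the denominator is positive. *)
        left; apply Rinv_0_lt_compat, exp_pos. }
    assert (HC := cumulants_of_moments _ (norm_cumulant a) (norm_moment a) M0 MS (HM BM HG)).
    intros [|[|[|k]]] Hk eps He; try lia.
    generalize (filter_and _ _ HD (proj1 (lim_eps _ _ _) (HC (S (S k))) eps He)).
    apply filter_imp; intros s [Hs H].
    simpl gcum in H; rewrite norm_cumulant_ratio, Rminus_0_r in H by auto; exact H.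
  - intros HR.
    apply gaussian_of_norm_moment_limit; auto.
    apply (moments_of_cumulants _ (norm_cumulant a)); auto.
    intros [|[|i]].
    + apply (filterlim_ext (fun _ => 0)); [|apply filterlim_const].
      intros s; symmetry; apply norm_cumulant_0.
    + apply (filterlim_ext_loc (fun _ => 1)); [|apply filterlim_const].
      revert HD; apply filter_imp; intros s Hs; symmetry; now apply norm_cumulant_1.
    + apply lim_eps; auto; intros eps He.
      generalize (filter_and _ _ HD (HR (S (S (S i))) ltac:(lia) eps He)).
      apply filter_imp; intros s [Hs H].
      simpl gcum; rewrite norm_cumulant_ratio, Rminus_0_r by auto; exact H.
Qed.
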